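(* Let the density $\rho$ be determined by $\rho(\boldsymbol{M}(\widehat{\boldsymbol{x}},t),t)=\rho_0(\widehat{\boldsymbol{x}})/\mathcal{J}_{\boldsymbol{M}}(\widehat{\boldsymbol{x}},t)$, and let $(\boldsymbol{J},\boldsymbol{u},\phi,p)$ be a sufficiently regular solution of the mixed weak formulation (W) of the variable-density incompressible inductionless MHD system given in the context. Define $$\mathcal{E}(t):=\frac12\int_{\Omega(t)}\rho|\boldsymbol{u}|^2\,\mathrm{d}\boldsymbol{x},\qquad \mathcal{D}(t):=\frac{1}{\mathrm{Re}}\bigl(2\nu\boldsymbol{D}(\boldsymbol{u}),\boldsymbol{D}(\boldsymbol{u})\bigr)_{\Omega(t)}+\alpha\bigl(\sigma^{-1}\boldsymbol{J},\boldsymbol{J}\bigr)_{\Omega(t)}.$$ Then, for $t\in(0,T)$, $$\frac{d\mathcal{E}}{dt}+\mathcal{D}(t)=(\rho\boldsymbol{f}_u,\boldsymbol{u})_{\Omega(t)}.$$ In particular, if $\boldsymbol{f}_u=\boldsymbol{0}$, then $$\mathcal{E}(t)+\int_0^t\mathcal{D}(s)\,\mathrm{d}s=\mathcal{E}(0),\qquad t\in[0,T],$$ and consequently $\mathcal{E}(t)\le\mathcal{E}(0)$.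
   Context: Let $T>0$. For each $t\in[0,T]$, $\Omega(t)\subset\mathbb{R}^3$ is a bounded Lipschitz domain, $\Omega_0:=\Omega(0)$, and $(\cdot,\cdot)_{\Omega(t)}$ denotes the $L^2(\Omega(t))$ inner product (of scalars, vectors or tensors). Flow map: $\boldsymbol{M}(\cdot,t):\Omega_0\to\Omega(t)$ satisfies $\boldsymbol{M}(\widehat{\boldsymbol{x}},0)=\widehat{\boldsymbol{x}}$, $\frac{\partial\boldsymbol{M}}{\partial t}(\widehat{\boldsymbol{x}},t)=\boldsymbol{u}(\boldsymbol{M}(\widehat{\boldsymbol{x}},t),t)$, and is for each $t$ an orientation-preserving diffeomorphism of $\Omega_0$ onto $\Omega(t)$; $\mathcal{J}_{\boldsymbol{M}}:=\det(\nabla_{\widehat{\boldsymbol{x}}}\boldsymbol{M})>0$. Material data: $\rho_0,\sigma_0,\nu_0:\Omega_0\to\mathbb{R}$ (possibly discontinuous) are measurable, bounded above and bounded below by positive constants. The conductivity $\sigma$ and viscosity $\nu$ are transported: $\sigma(\boldsymbol{M}(\widehat{\boldsymbol{x}},t),t)=\sigma_0(\widehat{\boldsymbol{x}})$, $\nu(\boldsymbol{M}(\widehat{\boldsymbol{x}},t),t)=\nu_0(\widehat{\boldsymbol{x}})$. The applied magnetic field $\boldsymbol{B}=\boldsymbol{B}(\boldsymbol{x})$ is prescribed (bounded), $\boldsymbol{f}_u$ is a prescribed body force per unit mass, and $\mathrm{Re}>0$, $\alpha\ge0$ are constants. $\boldsymbol{D}(\boldsymbol{u}):=\frac12(\nabla\boldsymbol{u}+(\nabla\boldsymbol{u})^T)$,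 and $\frac{d\boldsymbol{u}}{dt}:=\frac{\partial\boldsymbol{u}}{\partial t}+(\boldsymbol{u}\cdot\nabla)\boldsymbol{u}$ is the material derivative, i.e. $\frac{d\boldsymbol{u}}{dt}(\boldsymbol{M}(\widehat{\boldsymbol{x}},t),t)=\frac{\partial}{\partial t}\bigl[\boldsymbol{u}(\boldsymbol{M}(\widehat{\boldsymbol{x}},t),t)\bigr]$. Spaces: $\boldsymbol{W}(t):=\boldsymbol{H}(\mathrm{div};\Omega(t))$, $\boldsymbol{V}(t):=\boldsymbol{H}^1_0(\Omega(t))=[H^1_0(\Omega(t))]^3$, $S(t):=L^2(\Omega(t))$, $Q(t):=L^2_0(\Omega(t))$ (mean-zero $L^2$ functions). Weak formulation (W): for every $t\in(0,T]$, $(\boldsymbol{J}(t),\boldsymbol{u}(t),\phi(t),p(t))\in\boldsymbol{W}(t)\times\boldsymbol{V}(t)\times S(t)\times Q(t)$ satisfies, for all $\boldsymbol{\varphi}\in\boldsymbol{W}(t)$, $\boldsymbol{v}\in\boldsymbol{V}(t)$, $r\in S(t)$, $q\in Q(t)$, $$(\sigma^{-1}\boldsymbol{J},\boldsymbol{\varphi})_{\Omega(t)}-(\phi,\nabla\cdot\boldsymbol{\varphi})_{\Omega(t)}-(\boldsymbol{u}\times\boldsymbol{B},\boldsymbol{\varphi})_{\Omega(t)}=0,$$ $$\Bigl(\rho\frac{d\boldsymbol{u}}{dt},\boldsymbol{v}\Bigr)_{\Omega(t)}+\frac{1}{\mathrm{Re}}\bigl(2\nu\boldsymbol{D}(\boldsymbol{u}),\boldsymbol{D}(\boldsymbol{v})\bigr)_{\Omega(t)}-(p,\nabla\cdot\boldsymbol{v})_{\Omega(t)}-\alpha(\boldsymbol{J}\times\boldsymbol{B},\boldsymbol{v})_{\Omega(t)}=(\rho\boldsymbol{f}_u,\boldsymbol{v})_{\Omega(t)},$$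 $$-(\nabla\cdot\boldsymbol{J},r)_{\Omega(t)}=0,\qquad -(\nabla\cdot\boldsymbol{u},q)_{\Omega(t)}=0.$$ ''Sufficiently regular'' may be read as: all terms above are well defined, and $\widehat{\boldsymbol{u}}(\widehat{\boldsymbol{x}},t):=\boldsymbol{u}(\boldsymbol{M}(\widehat{\boldsymbol{x}},t),t)$ belongs to $C^1([0,T];[L^2(\Omega_0)]^3)$. *)

(* Defs.v *)
From HB Require Import structures.
From mathcomp Require Import all_boot all_order all_algebra.
From mathcomp Require Import all_classical all_reals all_analysis.

Set Implicit Arguments.
Unset Strict Implicit.
Unset Printing Implicit Defensive.
Import Order.TTheory GRing.Theory Num.Theory.
Import numFieldNormedType.Exports.

Local Open Scope classical_set_scope.
Local Open Scope ring_scope.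

(* The sigma-algebra on R^n generated by the coordinates, as in the library's
   instance for n-tuples; for n = 3 it is the Borel sigma-algebra. *)
Definition measure_rV_display (d : measure_display) : measure_display.
Proof. exact d. Qed.

Section measurable_rV.
Context {R : realType} (n : nat).

Definition rV_coord (i : 'I_n) (x : 'rV[R]_n) : R := x ord0 i.

Let rV_set0 : g_sigma_preimage rV_coord set0.
Proof. exact: sigma_algebra0. Qed.

Let rV_setC A : g_sigma_preimage rV_coord A -> g_sigma_preimage rV_coord (~` A).
Proof. exact: sigma_algebraC. Qed.

Let rV_bigcup (F : (set 'rV[R]_n)^nat) :
  (forall i, g_sigma_preimage rV_coord (F i)) ->
  g_sigma_preimage rV_coord (\bigcup_i (F i)).
Proof. exact: sigma_algebra_bigcup. Qed.

HB.instance Definition _ :=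
  @isMeasurable.Build (measure_rV_display default_measure_display)
    'rV[R]_n (g_sigma_preimage rV_coord) rV_set0 rV_setC rV_bigcup.

End measurable_rV.

Definition rV3 {R : realType} (p : R * R * R) : 'rV[R]_3 :=
  \row_i [:: p.1.1; p.1.2; p.2]`_i.

Lemma measurable_rV3 {R : realType} : measurable_fun
  [set: measurableTypeR R * measurableTypeR R * measurableTypeR R]
  (rV3 : measurableTypeR R * measurableTypeR R * measurableTypeR R -> 'rV[R]_3).
Proof.
have mcoord (i : 'I_3) : measurable_fun
    [set: measurableTypeR R * measurableTypeR R * measurableTypeR R]
    ((fun p => [:: p.1.1; p.1.2; p.2]`_i) :
       measurableTypeR R * measurableTypeR R * measurableTypeR R ->
       measurableTypeR R).
  case: i => -[|[|[|//]]] /= _.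
  - exact: (measurableT_comp measurable_fst measurable_fst).
  - exact: (measurableT_comp measurable_snd measurable_fst).
  - exact: measurable_snd.
apply: (measurability
  (\big[setU/set0]_(i < 3)
     preimage_set_system setT (@rV_coord R 3 i) measurable)) => //.
move=> _ [A + <-].
rewrite -bigcup_mkord_ord => -[i /= i3 [C mC <-]].
rewrite !setTI -comp_preimage -[X in measurable X]setTI.
rewrite (_ : _ \o _ = fun p => [:: p.1.1; p.1.2; p.2]`_(inord i : 'I_3)).
  exact: mcoord.
by apply/funext => p /=; rewrite /rV_coord mxE.
Qed.

(* Lebesgue measure on R^3, carried by row vectors. *)
Definition lebesgue3 {R : realType} : set 'rV[R]_3 -> \bar R :=
  pushforward (@lebesgue_measure R \x @lebesgue_measure R
               \x @lebesgue_measure R)%E rV3.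

Section lebesgue3_measure.
Local Open Scope ereal_scope.
Context {R : realType}.

Let lebesgue3_0 : @lebesgue3 R set0 = 0.
Proof. by rewrite /lebesgue3 /pushforward preimage_set0 measure0. Qed.

Let lebesgue3_ge0 A : 0 <= @lebesgue3 R A.
Proof. by rewrite /lebesgue3 /pushforward measure_ge0. Qed.

Let lebesgue3_sigma_additive : semi_sigma_additive (@lebesgue3 R).
Proof.
have mpre A : measurable A -> measurable (@rV3 R @^-1` A).
  by move=> mA; rewrite -[X in measurable X]setTI; exact: measurable_rV3.
move=> F mF tF mUF; rewrite /lebesgue3 /pushforward preimage_bigcup.
apply: measure_semi_sigma_additive.
- by move=> n; exact: mpre.
- apply/trivIsetP => i j _ _ ij; rewrite -preimage_setI.
  by move/trivIsetP : tF => -> //; rewrite preimage_set0.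
- by rewrite -preimage_bigcup; exact: mpre.
Qed.

HB.instance Definition _ := isMeasure.Build _ _ _ (@lebesgue3 R)
  lebesgue3_0 lebesgue3_ge0 lebesgue3_sigma_additive.

End lebesgue3_measure.

Section algebra.
Context {R : realType}.
Implicit Types a b : 'rV[R]_3.

Definition dotv a b : R := \sum_i a 0 i * b 0 i.

(* Indices in 'I_3 are added modulo 3. *)
Definition crossv a b : 'rV[R]_3 :=
  \row_i (a 0 (i + 1) * b 0 (i - 1) - a 0 (i - 1) * b 0 (i + 1)).

Definition ddotm (A B : 'M[R]_3) : R := \sum_i \sum_j A i j * B i j.

End algebra.

Section domains.
Context {R : realType}.
Implicit Type Omega : set 'rV[R]_3.

(* Near x0, after a rotation of the axes, Omega is the strict epigraph of a
   Lipschitz function of the first two coordinates. *)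
Definition lipschitz_boundary_at Omega (x0 : 'rV[R]_3) : Prop :=
  exists (Q : 'M[R]_3) (gamma : R * R -> R) (r L : R),
    [/\ Q *m Q^T = 1%:M, 0 < r, L.-lipschitz gamma &
     forall x, `|x - x0| < r ->
       let y := (x - x0) *m Q in
       Omega x <-> gamma (y 0 0, y 0 1) < y 0 ord_max].

Definition bounded_lipschitz_domain Omega : Prop :=
  [/\ open Omega, connected Omega, Omega !=set0, bounded_set Omega &
      forall x0, (closure Omega `\` Omega) x0 ->
        lipschitz_boundary_at Omega x0].

Definition C1_on (A : set 'rV[R]_3) (F : 'rV[R]_3 -> 'rV[R]_3) : Prop :=
  (forall x, A x -> differentiable F x) /\ {within A, continuous (jacobian F)}.

Definition diffeomorphism (A B : set 'rV[R]_3) (F : 'rV[R]_3 -> 'rV[R]_3)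
    : Prop :=
  set_bij A B F /\ C1_on A F /\
  exists2 G, C1_on B G & forall x, A x -> G (F x) = x.

End domains.

Section function_spaces.
Context {R : realType}.
Implicit Types (Omega : set 'rV[R]_3) (f g phi : 'rV[R]_3 -> R).
Implicit Types (v w : 'rV[R]_3 -> 'rV[R]_3) (A B : 'rV[R]_3 -> 'M[R]_3).

Definition inner_s Omega f g : R := \int[lebesgue3]_(x in Omega) (f x * g x).
Definition inner_v Omega v w : R :=
  \int[lebesgue3]_(x in Omega) dotv (v x) (w x).
Definition inner_m Omega A B : R :=
  \int[lebesgue3]_(x in Omega) ddotm (A x) (B x).

Definition coordf v (i : 'I_3) : 'rV[R]_3 -> R := fun x => v x 0 i.

Definition L2 Omega f : Prop := f \_ Omega \in Lfun lebesgue3 2%:E.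
Definition L2v Omega v : Prop := forall i, L2 Omega (coordf v i).
Definition L20 Omega f : Prop :=
  L2 Omega f /\ \int[lebesgue3]_(x in Omega) f x = 0.

Definition partial (i : 'I_3) f : 'rV[R]_3 -> R :=
  fun x => 'D_(delta_mx 0 i) f x.

Fixpoint Ck (k : nat) f : Prop :=
  if k is k'.+1 then
    (forall x, differentiable f x) /\ (forall i, Ck k' (partial i f))
  else continuous f.

Definition test_function Omega phi : Prop :=
  (forall k, Ck k phi) /\
  exists K, [/\ compact K, K `<=` Omega & forall x, ~ K x -> phi x = 0].

Definition is_weak_partial Omega i f g : Prop :=
  forall phi, test_function Omega phi ->
    inner_s Omega f (partial i phi) = - inner_s Omega g phi.

Definition is_weak_div Omega v g : Prop :=
  forall phi, test_function Omega phi ->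
    \int[lebesgue3]_(x in Omega) (\sum_i v x 0 i * partial i phi x) =
    - inner_s Omega g phi.

(* Total versions: some L^2 representative if there is one, and 0 otherwise. *)
Definition wpartial Omega i f : 'rV[R]_3 -> R :=
  xget (cst 0) [set g | L2 Omega g /\ is_weak_partial Omega i f g].

Definition wdiv Omega v : 'rV[R]_3 -> R :=
  xget (cst 0) [set g | L2 Omega g /\ is_weak_div Omega v g].

Definition wgrad Omega v : 'rV[R]_3 -> 'M[R]_3 :=
  fun x => \matrix_(i, j) wpartial Omega j (coordf v i) x.

Definition symgrad Omega v : 'rV[R]_3 -> 'M[R]_3 :=
  fun x => 2^-1 *: (wgrad Omega v x + (wgrad Omega v x)^T).

Definition Hdiv Omega v : Prop :=
  L2v Omega v /\ exists2 g, L2 Omega g & is_weak_div Omega v g.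

Definition H1 Omega f : Prop :=
  L2 Omega f /\
  forall i, exists2 g, L2 Omega g & is_weak_partial Omega i f g.

Definition H1_norm Omega f : R :=
  Num.sqrt (inner_s Omega f f +
    \sum_i inner_s Omega (wpartial Omega i f) (wpartial Omega i f)).

(* The closure of the test functions in H^1. *)
Definition H10 Omega f : Prop :=
  H1 Omega f /\
  forall e : R, 0 < e ->
    exists2 phi, test_function Omega phi & H1_norm Omega (f \- phi) < e.

Definition H10v Omega v : Prop := forall i, H10 Omega (coordf v i).

(* g belongs to C^1([0, T]; L^2(Omega)^3) and dg is its derivative, one-sided
   at the endpoints. *)
Definition C1_L2 (T : R) Omega (g dg : R -> 'rV[R]_3 -> 'rV[R]_3) : Prop :=
  forall t, 0 <= t <= T ->
    let err s x := (s - t)^-1 *: (g s x - g t x) - dg t x in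
    let inc s x := dg s x - dg t x in
    [/\ L2v Omega (g t), L2v Omega (dg t),
        inner_v Omega (err s) (err s) @[s --> within `[0, T] t^'] --> (0 : R) &
        inner_v Omega (inc s) (inc s) @[s --> within `[0, T] (nbhs t)]
          --> (0 : R)].

End function_spaces.

Section model.
Context {R : realType}.
Local Notation V3 := 'rV[R]_3.

Record flow_map (T : R) (Omega : R -> set V3) (u M : R -> V3 -> V3) : Prop :=
  FlowMap {
  flow_init : forall x, Omega 0 x -> M 0 x = x;
  flow_velocity : forall t x, 0 <= t <= T -> Omega 0 x ->
    (s - t)^-1 *: (M s x - M t x) @[s --> within `[0, T] t^'] --> u t (M t x);
  flow_diffeo : forall t, 0 <= t <= T ->
    diffeomorphism (Omega 0) (Omega t) (M t);
  flow_orientation : forall t x, 0 <= t <= T -> Omega 0 x ->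
    0 < \det ('J (M t) x) }.

Definition material_datum (Omega : set V3) (a : V3 -> R) : Prop :=
  measurable_fun Omega a /\
  exists c C : R, 0 < c /\ forall x, Omega x -> c <= a x <= C.

Definition transported (T : R) (Omega0 : set V3) (M : R -> V3 -> V3)
    (a0 : V3 -> R) (a : R -> V3 -> R) : Prop :=
  forall t x, 0 <= t <= T -> Omega0 x -> a t (M t x) = a0 x.

Definition density_transported (T : R) (Omega0 : set V3) (M : R -> V3 -> V3)
    (rho0 : V3 -> R) (rho : R -> V3 -> R) : Prop :=
  forall t x, 0 <= t <= T -> Omega0 x ->
    rho t (M t x) = rho0 x / \det ('J (M t) x).

(* The Lagrangian characterisation of du/dt = D_t u + (u . grad) u:
   du/dt (M(x, t), t) is the time derivative of u (M(x, t), t). *)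
Definition material_derivative (T : R) (Omega0 : set V3)
    (M u du : R -> V3 -> V3) : Prop :=
  C1_L2 T Omega0 (fun t x => u t (M t x)) (fun t x => du t (M t x)).

(* At a fixed time; du stands for the material derivative of u. *)
Definition weak_MHD (Omega : set V3) (Re alpha : R) (B : V3 -> V3)
    (rho sigma nu : V3 -> R) (f : V3 -> V3)
    (J u du : V3 -> V3) (phi p : V3 -> R) : Prop :=
  [/\ Hdiv Omega J, H10v Omega u, L2 Omega phi & L20 Omega p] /\
  [/\ forall psi, Hdiv Omega psi ->
        inner_v Omega (fun x => (sigma x)^-1 *: J x) psi
        - inner_s Omega phi (wdiv Omega psi)
        - inner_v Omega (fun x => crossv (u x) (B x)) psi = 0,
      forall v, H10v Omega v ->
        inner_v Omega (fun x => rho x *: du x) v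
        + Re^-1 * inner_m Omega (fun x => (2 * nu x) *: symgrad Omega u x)
                                (symgrad Omega v)
        - inner_s Omega p (wdiv Omega v)
        - alpha * inner_v Omega (fun x => crossv (J x) (B x)) v
        = inner_v Omega (fun x => rho x *: f x) v,
      forall r, L2 Omega r -> - inner_s Omega (wdiv Omega J) r = 0 &
      forall q, L20 Omega q -> - inner_s Omega (wdiv Omega u) q = 0].

(* The integrands of [weak_MHD] that are not integrable by Cauchy-Schwarz and
   the boundedness of 1 / sigma, nu and B. *)
Definition inertia_and_force_integrable (Omega : set V3) (rho : V3 -> R)
    (f du : V3 -> V3) : Prop :=
  forall v, H10v Omega v ->
    lebesgue3.-integrable Omega
      (fun x => (dotv (rho x *: du x) (v x))%:E) /\
    lebesgue3.-integrable Omega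
      (fun x => (dotv (rho x *: f x) (v x))%:E).

Definition energy (Omega : set V3) (rho : V3 -> R) (u : V3 -> V3) : R :=
  2^-1 * \int[lebesgue3]_(x in Omega) (rho x * dotv (u x) (u x)).

Definition dissipation (Omega : set V3) (Re alpha : R) (sigma nu : V3 -> R)
    (J u : V3 -> V3) : R :=
  Re^-1 * inner_m Omega (fun x => (2 * nu x) *: symgrad Omega u x)
                        (symgrad Omega u)
  + alpha * inner_v Omega (fun x => (sigma x)^-1 *: J x) J.

End model.

(* Main.v *)
From HB Require Import structures.
Require Import Defs.
From mathcomp Require Import all_boot all_order all_algebra fingroup perm.
From mathcomp Require Import all_classical all_reals all_analysis.
From mathcomp Require Import measurable_realfun.
From mathcomp Require Import ring lra.

Set Implicit Arguments.
Unset Strict Implicit.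
Unset Printing Implicit Defensive.

Import Order.TTheory GRing.Theory Num.Theory.
Import numFieldNormedType.Exports.

Local Open Scope classical_set_scope.
Local Open Scope ring_scope.

(** The energy law follows from testing the weak formulation with the solution
    itself, once the time derivative of the kinetic energy is known.

    The first part is algebra ([weak_MHD_energy]). Choosing v = u in the momentum
    equation and J in Ohm's law, the pressure and the potential drop out by the
    two divergence constraints, and the Lorentz force (J x B, u) cancels the
    electromotive term (u x B, J). This leaves
    (rho du/dt, u) + D = (rho f, u) at each positive time.

    The second part is that (rho du/dt, u) is the derivative of the energy E.
    The density is the initial one divided by the Jacobian determinant of the flow
    map, so the change of variables x = M (x0, t) turns E t into half the integral
    of rho0 |u^|^2 over the fixed domain Omega 0, where u^ is the velocity in
    Lagrangian coordinates, and (rho du/dt, u) into the integral of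
    rho0 u^ . du^/dt ([diffeomorphism_pullback]). As u^ is a C^1 curve in L^2 and
    rho0 is bounded, the first quadratic expression is differentiable in time with
    the second one as its derivative, and the latter is continuous
    ([form_energy_quotient], [form_power_cvg]). Without forcing, E' = - D, and
    integrating in time gives the energy identity ([energy_FTC]).

    What takes most of the work is the change of variables formula for C^1
    diffeomorphisms of open sets in R^3 ([change_of_variables]). Volumes of linear
    images are found from the uniqueness of translation invariant measures up to a
    factor, which makes that factor multiplicative in the matrix
    ([lebesgue3_linear]). Near a point, the map and its inverse are close to their
    affine approximations, so the volume of the image of a small box is nearly
    |det| times the volume of the box ([local_upper], [local_lower]). Bisection
    ([box_induction]) propagates this to the equality of the image measure with
    the measure of density |det|, first on boxes, then on Borel sets and for
    integrals. *)

(** * Three coordinates *)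

Definition o0 : 'I_3 := Ordinal (isT : (0 < 3)%N).
Definition o1 : 'I_3 := Ordinal (isT : (1 < 3)%N).
Definition o2 : 'I_3 := Ordinal (isT : (2 < 3)%N).

Lemma ord3_ind (Q : 'I_3 -> Prop) : Q o0 -> Q o1 -> Q o2 -> forall i, Q i.
Proof.
move=> q0 q1 q2 [[|[|[|//]]] p].
- by rewrite (_ : Ordinal p = o0)//; exact: val_inj.
- by rewrite (_ : Ordinal p = o1)//; exact: val_inj.
- by rewrite (_ : Ordinal p = o2)//; exact: val_inj.
Qed.

Lemma sum_ord3 (R : nmodType) (F : 'I_3 -> R) :
  \sum_i F i = F o0 + F o1 + F o2.
Proof.
rewrite !big_ord_recr big_ord0/= add0r.
by congr (F _ + F _ + F _); exact: val_inj.
Qed.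

(** * Boxes and the Borel sets of R^3 *)

Section borel.
Context {R : realType}.
Local Notation V := 'rV[R]_3.

Lemma measurable_coord (i : 'I_3) :
  measurable_fun [set: V] (fun x : V => x 0 i : measurableTypeR R).
Proof.
move=> _ C mC; rewrite setTI; apply: sub_sigma_algebra.
rewrite -bigcup_mkord_ord; exists i => //=.
by exists C => //; rewrite setTI inord_val.
Qed.

Lemma measurable_fun_rV {d} {X : measurableType d} (D : set X) (f : X -> V) :
  (forall i, measurable_fun D (fun x => f x 0 i : measurableTypeR R)) ->
  measurable_fun D f.
Proof.
move=> mf mD; move: (mD); apply: (measurability
  (\big[setU/set0]_(i < 3)
     preimage_set_system setT (@rV_coord R 3 i) measurable)) => //.
move=> _ [A + <-].
rewrite -bigcup_mkord_ord => -[i /= i3 [C mC <-]].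
by rewrite setTI; exact: (mf (inord i) mD C mC).
Qed.

Lemma norm_coord_lt_nat (x : V) : exists n : nat, forall k, `|x 0 k| < n%:R.
Proof.
exists (Num.truncn (\sum_k `|x 0 k|)).+1 => k.
apply: le_lt_trans (truncnS_gt _).
by rewrite (bigD1 k)//= lerDl sumr_ge0.
Qed.

Definition box (a b : V) : set V := [set x | forall i, a 0 i <= x 0 i < b 0 i].

Lemma measurable_box (a b : V) : measurable (box a b).
Proof.
rewrite (_ : box a b = \bigcap_i
    ((fun x : V => x 0 i : measurableTypeR R) @^-1` `[a 0 i, b 0 i[%classic)).
  apply: fin_bigcap_measurable => // i _.
  by rewrite -[X in measurable X]setTI; exact: measurable_coord.
apply/seteqP; split => [x xab i _|x xab i].
  by rewrite /= in_itv/=; exact: xab.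
by have := xab i I; rewrite /= in_itv.
Qed.

Lemma boxI (a b c d : V) : box a b `&` box c d =
  box (\row_i Num.max (a 0 i) (c 0 i)) (\row_i Num.min (b 0 i) (d 0 i)).
Proof.
apply/seteqP; split => [x [xab xcd] i|x xI]; last split => i.
- rewrite !mxE ge_max lt_min.
  by case/andP: (xab i) => -> ->; case/andP: (xcd i) => -> ->.
- by have := xI i; rewrite !mxE ge_max lt_min => /andP[/andP[-> _] /andP[-> _]].
- by have := xI i; rewrite !mxE ge_max lt_min => /andP[/andP[_ ->] /andP[_ ->]].
Qed.

Definition boxes : set (set V) := [set Q | exists a b, Q = box a b].

Lemma setI_closed_boxes : setI_closed boxes.
Proof. by move=> _ _ [a [b ->]] [c [d ->]]; rewrite boxI; do 2 eexists. Qed.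

(** The cylinder over [r, +oo[ in one coordinate is a countable union of boxes
    whose other sides grow, and these cylinders generate all of them. *)
Lemma measurable_rVE : @measurable _ V = <<s boxes >>.
Proof.
apply/seteqP; split; last first.
  apply: smallest_sub; first exact: sigma_algebra_measurable.
  by move=> _ [a [b ->]]; exact: measurable_box.
apply: smallest_sub; first exact: smallest_sigma_algebra.
move=> A; rewrite -bigcup_mkord_ord => -[i _ [C mC <-]].
set j := inord i : 'I_3.
suff mj : measurable_fun [set: g_sigma_algebraType boxes]
    (@rV_coord R 3 j : _ -> measurableTypeR R) by exact: mj.
apply: (measurability (@RGenCInfty.G R)).
  exact: RGenCInfty.measurableE.
move=> _ [_ [r ->] <-].
rewrite (_ : setT `&` _ = \bigcup_(n : nat)
  box (\row_k if k == j then r else - n%:R) (\row_k n%:R)).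
  apply: bigcupT_measurable => n; apply: sub_sigma_algebra.
  by do 2 eexists; reflexivity.
apply/seteqP; split => [x [_]|x [n _ xn]] /=.
  rewrite in_itv/= andbT /rV_coord => rx.
  have [n xn] := norm_coord_lt_nat x; exists n => // k.
  have := xn k; rewrite ltr_norml => /andP[nx {}xn].
  by rewrite !mxE xn andbT; case: eqP => [->//|_]; exact: ltW.
split => //; have := xn j; rewrite !mxE eqxx => /andP[+ _].
by rewrite in_itv/= andbT.
Qed.

Definition centered_box (n : nat) : set V := box (\row__ - n%:R) (\row__ n%:R).

Lemma bigcup_centered_box : \bigcup_n centered_box n = setT.
Proof.
rewrite -subTset => x _; have [n xn] := norm_coord_lt_nat x.
by exists n => // k; have := xn k; rewrite ltr_norml !mxE => /andP[/ltW -> ->].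
Qed.

(** Boxes are stable under intersection, hence Dynkin's theorem applies. Each
    identity between measures below is reduced to boxes in this way. *)
Lemma box_measure_unique (m1 m2 : {measure set V -> \bar R}) :
  (forall a b, m1 (box a b) = m2 (box a b)) ->
  (forall n, m1 (centered_box n) < +oo)%E ->
  forall A, measurable A -> m1 A = m2 A.
Proof.
move=> m12 m1oo A mA.
apply: (measure_unique boxes centered_box) => //.
- exact: measurable_rVE.
- exact: setI_closed_boxes.
- by move=> n; do 2 eexists; reflexivity.
- exact: bigcup_centered_box.
- by move=> _ [a [b ->]].
Qed.

Lemma lebesgue3_box (a b : V) : (forall i, a 0 i <= b 0 i) ->
  lebesgue3 (box a b) = (\prod_i (b 0 i - a 0 i))%:E.
Proof.
move=> ab.
rewrite /lebesgue3 /pushforward.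
pose I i : set (measurableTypeR R) := `[a 0 i, b 0 i[%classic.
have -> : @rV3 R @^-1` box a b =
    (I (inord 0) `*` I (inord 1)) `*` I (inord 2).
  apply/seteqP; split => [[[x y] z] xab|[[x y] z] [[/= x0 y0] z0]] /=.
    have := (xab (inord 0), xab (inord 1), xab (inord 2)).
    by rewrite !mxE/= !inordK//= /I/= !in_itv/= => -[[]].
  case => -[|[|[|//]]] /= p; rewrite !mxE/=.
  - by rewrite -(_ : inord 0 = Ordinal p) //; apply/val_inj; rewrite /= inordK.
  - by rewrite -(_ : inord 1 = Ordinal p) //; apply/val_inj; rewrite /= inordK.
  - by rewrite -(_ : inord 2 = Ordinal p) //; apply/val_inj; rewrite /= inordK.
have mI i : measurable (I i) by exact: measurable_itv.
transitivity (lebesgue_measure (I (inord 0)) * lebesgue_measure (I (inord 1)) *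
    lebesgue_measure (I (inord 2)))%E.
  rewrite product_measure1E//; last exact: measurableX.
  by rewrite [X in (X * _)%E]product_measure1E.
have lI i : lebesgue_measure (I i) = (b 0 i - a 0 i)%:E.
  rewrite lebesgue_measure_itv/= lte_fin; case: ltP => // ba.
  by have := ab i; rewrite le_eqVlt ltNge ba orbF => /eqP ->; rewrite subrr.
rewrite !lI -!EFinM !big_ord_recr big_ord0/= mul1r; congr EFin.
by congr (_ * _ * _); congr (b 0 _ - a 0 _); apply/val_inj; rewrite /= inordK.
Qed.

Lemma box_eq0 (a b : V) i : b 0 i <= a 0 i -> box a b = set0.
Proof.
move=> ba; rewrite -subset0 => x /(_ i) /andP[ax xb].
by have := lt_le_trans xb ba; rewrite ltNge ax.
Qed.

Lemma lebesgue3_box_lty (a b : V) : (lebesgue3 (box a b) < +oo)%E.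
Proof.
have [ab|] := pselect (forall i, a 0 i <= b 0 i).
  by rewrite lebesgue3_box// ltry.
by move=> /existsNP[i /negP]; rewrite -ltNge => /ltW/box_eq0 ->; rewrite measure0.
Qed.

Lemma sigma_finite_lebesgue3 : sigma_finite setT (@lebesgue3 R).
Proof.
exists centered_box; first by rewrite bigcup_centered_box.
by move=> n; split; [exact: measurable_box|exact: lebesgue3_box_lty].
Qed.

HB.instance Definition _ := Measure_isSigmaFinite.Build _ _ _ (@lebesgue3 R)
  sigma_finite_lebesgue3.

Definition cbox (a b : V) : set V := [set x | forall i, a 0 i <= x 0 i <= b 0 i].

Lemma box_sub_cbox (a b : V) : box a b `<=` cbox a b.
Proof. by move=> x xab i; case/andP: (xab i) => -> /ltW ->. Qed.

(** The boxes are chosen with their closures inside the open set, since the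
    change of variables is first established on such boxes. *)
Lemma open_bigcup_box (A : set V) : open A ->
  exists a b : nat -> V, A = \bigcup_n box (a n) (b n) /\
    forall n, cbox (a n) (b n) `<=` A.
Proof.
move=> oA.
(* The rational boxes are enumerated by [pickle]; a box that leaves A is
   replaced by the empty one, which runs from 1 down to 0. *)
pose ends (n : nat) : V * V :=
  if @unpickle ('rV[rat]_3 * 'rV[rat]_3)%type n is Some pq then
    (map_mx ratr pq.1, map_mx ratr pq.2) else (const_mx 1, const_mx 0).
pose e n := if pselect (cbox (ends n).1 (ends n).2 `<=` A) then ends n
  else (const_mx 1, const_mx 0).
have eA n : cbox (e n).1 (e n).2 `<=` A.
  rewrite /e; case: pselect => //= _ x /(_ 0); rewrite !mxE => /andP[x1 x0].
  by have := le_trans x1 x0; rewrite ler10.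
exists (fun n => (e n).1), (fun n => (e n).2); split => //.
apply/seteqP; split => [x Ax|x [n _ /box_sub_cbox/eA]//].
have /nbhs_ballP[r/= r0 xrA] : nbhs x A by exact: open_nbhs_nbhs.
have lo i : exists q : rat, x 0 i - r < ratr q < x 0 i.
  have /rat_in_itvoo[q] : x 0 i - r < x 0 i by rewrite ltrBlDr ltrDl.
  by rewrite in_itv/=; exists q.
have hi i : exists q : rat, x 0 i < ratr q < x 0 i + r.
  have /rat_in_itvoo[q] : x 0 i < x 0 i + r by rewrite ltrDl.
  by rewrite in_itv/=; exists q.
pose p : 'rV[rat]_3 := \row_i sval (cid (lo i)).
pose q : 'rV[rat]_3 := \row_i sval (cid (hi i)).
have xpq : box (map_mx ratr p) (map_mx ratr q) x.
  move=> i; rewrite !mxE.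
  by case: cid => /= ? /andP[_ /ltW ->]; case: cid => /= ? /andP[-> _].
have pqA : cbox (map_mx ratr p) (map_mx ratr q) `<=` A.
  move=> y ypq; apply: xrA; split => // j i; rewrite !ord1.
  have := ypq i; rewrite !mxE /ball/= ltr_distlC.
  case: cid => /= ? /andP[lt1 _]; case: cid => /= ? /andP[_ lt2] /andP[ly yl].
  by rewrite (lt_le_trans lt1 ly) (le_lt_trans yl lt2).
exists (pickle (p, q)) => //.
have -> : e (pickle (p, q)) = (map_mx ratr p, map_mx ratr q); last by [].
by rewrite /e /ends pickleK; case: pselect.
Qed.

Lemma open_measurable_rV (A : set V) : open A -> measurable A.
Proof.
move=> /open_bigcup_box[a [b [-> _]]].
by apply: bigcupT_measurable => n; exact: measurable_box.
Qed.

Lemma continuous_measurable_rV (A : set V) (f : V -> R) : open A ->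
  {within A, continuous f} -> measurable_fun A (f : V -> measurableTypeR R).
Proof.
move=> oA cf mA; move: (mA); apply: (measurability (@RGenOpens.G R)).
  exact: RGenOpens.measurableE.
move=> _ [_ [p [q ->]] <-].
apply: open_measurable_rV.
by move: cf; rewrite continuous_open_subspace// continuous_inP//; apply.
Qed.

End borel.

(** * Volumes of linear images *)

Section linear.
Context {R : realType}.
Local Notation V := 'rV[R]_3.
Local Notation mu := (@lebesgue3 R).

Lemma measurable_translation (v : V) : measurable_fun [set: V] (fun x => x + v).
Proof.
apply: measurable_fun_rV => i.
under eq_fun do rewrite mxE.
by apply: measurable_funD => //; exact: measurable_coord.
Qed.

Lemma measurable_mulmxr (P : 'M[R]_3) :
  measurable_fun [set: V] (fun x => x *m P).
Proof.
apply: measurable_fun_rV => i.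
under eq_fun do rewrite mxE.
apply: measurable_sum => j.
by apply: measurable_funM => //; exact: measurable_coord.
Qed.

Lemma measurable_fun_addV d (X : measurableType d) (f g : X -> V) :
  measurable_fun setT f -> measurable_fun setT g ->
  measurable_fun setT (fun x => f x + g x).
Proof.
move=> mf mg; apply: measurable_fun_rV => i.
under eq_fun do rewrite mxE.
apply: measurable_funD.
- exact: (measurableT_comp (measurable_coord i) mf).
- exact: (measurableT_comp (measurable_coord i) mg).
Qed.

Definition image_measure {d d'} {X : measurableType d} {Y : measurableType d'}
  (m : {measure set X -> \bar R}) (f : X -> Y) (mf : measurable_fun setT f)
  : {measure set Y -> \bar R} :=
  measure_function_pushforward__canonical__measure_function_Measure m mf.

Lemma lebesgue3_translation (v : V) (A : set V) : measurable A ->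
  mu [set x | A (x + v)] = mu A.
Proof.
move=> mA.
pose tr : V -> V := fun x => x + v.
have mv : measurable_fun setT tr := measurable_translation v.
have trbox a b : tr @^-1` box a b = box (a - v) (b - v).
  by apply/seteqP; split => x xab i; have := xab i; rewrite /tr/= !mxE
    lerBlDr ltrBrDr.
pose m2 : {measure set V -> \bar R} := image_measure mu mv.
have H : forall a b, mu (box a b) = m2 (box a b).
  move=> a b; rewrite /m2 /= /pushforward trbox.
  have [ab|] := pselect (forall i, a 0 i <= b 0 i).
    rewrite [LHS]lebesgue3_box// [RHS]lebesgue3_box; last first.
      by move=> i; rewrite !mxE lerD2r.
    by congr EFin; apply: eq_bigr => i _; rewrite !mxE opprB addrA addrNK.
  move=> /existsNP[i /negP]; rewrite -ltNge => /ltW ba.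
  rewrite (@box_eq0 _ _ _ i ba) (@box_eq0 _ _ _ i) ?measure0//.
  by rewrite !mxE lerD2r.
have /esym := box_measure_unique H (fun n => lebesgue3_box_lty _ _) mA.
by [].
Qed.

Lemma tonelli_sections (S : set (V * V)) : measurable S ->
  (\int[mu]_x mu (xsection S x) = \int[mu]_y mu (ysection S y))%E.
Proof.
move=> mS.
apply: (@product_measure_unique _ _ _ _ R mu mu (mu \x^ mu)%E) => // A B mA mB.
exact: product_measure2E.
Qed.

Definition unit_box : set V := box (const_mx 0) (const_mx 1).

Lemma lebesgue3_unit_box : mu unit_box = 1%E.
Proof.
rewrite lebesgue3_box => [|i]; last by rewrite !mxE.
by congr EFin; rewrite big1// => i _; rewrite !mxE subr0.
Qed.

Definition unit_boxN : set V := [set z | unit_box (- z)].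

Lemma measurable_unit_boxN : measurable unit_boxN.
Proof.
rewrite (_ : unit_boxN = (fun x => x *m (-1)%:M) @^-1` unit_box); last first.
  by apply/seteqP; split => x; rewrite /unit_boxN/= mul_mx_scalar scaleN1r.
rewrite -[X in measurable X]setTI.
by apply: measurable_mulmxr => //; exact: measurable_box.
Qed.

(** Uniqueness of Haar measure, by Tonelli. Let U be the unit box and consider
    the pairs (x, y) with x P in - U and y + x P in B. The translation by x P
    in y gives their measure as the product on the right. The translation by
    y P^-1 in x turns them into the pairs with y - x P in U and x P in B, and
    as U has volume 1 these have the measure on the left. *)
Lemma lebesgue3_linear_proportional (P : 'M[R]_3) (B : set V) : P \in unitmx ->
  measurable B ->
  mu [set x | B (x *m P)] = (mu [set x | unit_boxN (x *m P)] * mu B)%E.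
Proof.
move=> uP mB.
pose S : set (V * V) :=
  [set z | unit_boxN (z.1 *m P)] `&` [set z | B (z.2 + z.1 *m P)].
pose S' : set (V * V) :=
  [set z | unit_box (z.2 + z.1 *m - P)] `&` [set z | B (z.1 *m P)].
have mN := measurable_unit_boxN.
have mU : measurable unit_box := measurable_box _ _.
have mpre (C : set V) (f : V * V -> V) : measurable C -> measurable_fun setT f ->
    measurable (f @^-1` C).
  by move=> mC mf; rewrite -[X in measurable X]setTI; exact: mf.
have mpre1 (C : set V) Q : measurable C -> measurable [set x : V | C (x *m Q)].
  move=> mC; rewrite -[X in measurable X]setTI.
  exact: (@measurable_mulmxr Q measurableT C).
have m1P (Q : 'M[R]_3) : measurable_fun setT (fun z : V * V => z.1 *m Q).
  exact: (measurableT_comp (measurable_mulmxr Q) measurable_fst).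
have mS : measurable S.
  apply: measurableI; apply: mpre => //.
  by apply: measurable_fun_addV.
have mS' : measurable S'.
  apply: measurableI; apply: mpre => //.
  by apply: measurable_fun_addV.
have intS : (\int[mu]_x mu (xsection S x) =
    mu [set x | unit_boxN (x *m P)] * mu B)%E.
  rewrite (eq_integral (fun x => (\1_[set x | unit_boxN (x *m P)] x)%:E * mu B)%E).
    rewrite ge0_integralZr//; last first.
      by apply/measurable_EFinP; apply: measurable_indic; exact: mpre1.
    by rewrite integral_indic ?setIT//; exact: mpre1.
  move=> x _; rewrite indicE /xsection; have [xN|xN] := boolP (_ \in _).
    rewrite mul1e -(lebesgue3_translation (x *m P) mB); congr (mu _).
    apply/seteqP; split => y; rewrite /S/= inE/=; first by case.
    by split => //; move: xN; rewrite inE.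
  rewrite mul0e -[RHS](measure0 mu); congr (mu _); rewrite -subset0 => y.
  by rewrite /= inE => -[/= xN' _]; move: xN; rewrite notin_setE; apply.
have intS' : (\int[mu]_x mu (xsection S' x) = mu [set x | B (x *m P)])%E.
  rewrite (eq_integral (fun x => (\1_[set x | B (x *m P)] x)%:E)%E).
    by rewrite integral_indic ?setIT//; exact: mpre1.
  move=> x _; rewrite indicE /xsection; have [xN|xN] := boolP (_ \in _).
    rewrite -lebesgue3_unit_box -(lebesgue3_translation (x *m - P) mU).
    congr (mu _); apply/seteqP; split => y; rewrite /S'/= inE/=; first by case.
    by split => //; move: xN; rewrite inE.
  rewrite -[RHS](measure0 mu); congr (mu _); rewrite -subset0 => y.
  by rewrite /= inE => -[/= _ xN']; move: xN; rewrite notin_setE; apply.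
apply: (etrans (esym intS')); apply: etrans intS.
apply: (etrans (tonelli_sections mS')).
apply: etrans (esym (tonelli_sections mS)).
apply: eq_integral => y _.
have mSy : measurable (ysection S y) by exact: measurable_ysection.
rewrite -(lebesgue3_translation (- (y *m invmx P)) mSy).
congr (mu _); apply/seteqP; rewrite /ysection/S/S'/unit_boxN.
have e x : (x - y *m invmx P) *m P = x *m P - y.
  by rewrite mulmxBl -mulmxA mulVmx// mulmx1.
have e' x : y + (x *m P - y) = x *m P by rewrite addrC subrK.
by split => x; rewrite /= !inE/= e e' opprB mulmxN.
Qed.

(** The factor by which preimages under x |-> x P scale volumes. As it is
    multiplicative in P, it can be computed from elementary matrices. *)
Definition lin_ratio (P : 'M[R]_3) : \bar R := mu [set x | unit_boxN (x *m P)].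
Local Notation c := lin_ratio.

Lemma measurable_lin_preimage (P : 'M[R]_3) (B : set V) : measurable B ->
  measurable [set x | B (x *m P)].
Proof.
move=> mC; rewrite -[X in measurable X]setTI.
exact: (@measurable_mulmxr P measurableT B).
Qed.

Lemma lin_ratio_unit_box (P : 'M[R]_3) : P \in unitmx ->
  c P = mu [set x | unit_box (x *m P)].
Proof.
move=> uP; rewrite (lebesgue3_linear_proportional uP); last exact: measurable_box.
by rewrite lebesgue3_unit_box mule1.
Qed.

Lemma lin_ratioM (P Q : 'M[R]_3) : P \in unitmx -> Q \in unitmx ->
  c (P *m Q) = (c P * c Q)%E.
Proof.
move=> uP uQ; rewrite lin_ratio_unit_box ?unitmx_mul ?uP//.
have mU : measurable unit_box by exact: measurable_box.
transitivity (mu [set x | [set y | unit_box (y *m Q)] (x *m P)]).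
  by congr (mu _); apply/seteqP; split => x/=; rewrite mulmxA.
rewrite (lebesgue3_linear_proportional uP); last exact: measurable_lin_preimage.
by rewrite -lin_ratio_unit_box.
Qed.

Lemma lin_ratio1 : c 1%:M = 1%E.
Proof.
rewrite lin_ratio_unit_box ?unitmx1// -lebesgue3_unit_box.
by congr (mu _); apply/seteqP; split => x /=; rewrite mulmx1.
Qed.

(** The ratios of P and of its inverse multiply to 1, which excludes both 0 and
    +oo. *)
Lemma lin_ratio_fin (P : 'M[R]_3) : P \in unitmx ->
  exists2 k : R, 0 < k & c P = k%:E.
Proof.
move=> uP.
have := lin_ratioM uP (_ : invmx P \in unitmx).
rewrite unitmx_inv mulmxV// lin_ratio1 => /(_ uP).
have : (0 <= c P)%E by exact: measure_ge0.
have : (0 <= c (invmx P))%E by exact: measure_ge0.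
case: (c P) => [k| |//]; case: (c (invmx P)) => [k'| |//].
- rewrite !lee_fin => k'0 k0 /eqP; rewrite -EFinM eqe => /eqP kk'.
  exists k => //; rewrite lt_neqAle k0 andbT; apply/eqP => k00.
  by move: kk'; rewrite -k00 mul0r => /eqP; rewrite oner_eq0.
- rewrite lee_fin => _ k0; move: k0; rewrite le_eqVlt => /predU1P[<-|k0].
    by rewrite mul0e => /eqP; rewrite eqe oner_eq0.
  by rewrite gt0_muley.
- rewrite lee_fin => + _; rewrite le_eqVlt => /predU1P[<-|k0].
    by rewrite mule0 => /eqP; rewrite eqe oner_eq0.
  by rewrite gt0_mulye.
- by rewrite mulyy.
Qed.

Lemma lin_ratio_sqr1 (P : 'M[R]_3) : P \in unitmx -> P *m P = 1%:M -> c P = 1%E.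
Proof.
move=> uP PP; have := lin_ratioM uP uP; rewrite PP lin_ratio1.
have [k k0 ->] := lin_ratio_fin uP; rewrite -EFinM => -[/esym/eqP].
by rewrite -expr2 sqrp_eq1 ?ltW// => /eqP ->.
Qed.

Lemma lin_ratio_perm (s : 'S_3) : c (perm_mx s) = 1%E.
Proof.
rewrite lin_ratio_unit_box ?unitmx_perm// -lebesgue3_unit_box; congr (mu _).
rewrite -[s]invgK; apply/seteqP; split => x; rewrite /= -col_permE => xs i.
  by have := xs (s i); rewrite !mxE permK.
by rewrite !mxE; have := xs ((s^-1)%g i); rewrite !mxE.
Qed.

Lemma lin_ratio_diag (d : V) : (forall i, d 0 i != 0) ->
  c (diag_mx d) = (`|\prod_i d 0 i|^-1)%:E.
Proof.
move=> d0.
(* The signs form an involution; the absolute values map boxes to boxes. *)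
pose s := \row_i Num.sg (d 0 i); pose p := \row_i `|d 0 i|.
have dsp : diag_mx d = diag_mx s *m diag_mx p.
  rewrite mulmx_diag; congr diag_mx; apply/rowP => i.
  by rewrite !mxE -numEsg.
have ud (e : V) : (forall i, e 0 i != 0) -> diag_mx e \in unitmx.
  by move=> e0; rewrite unitmxE det_diag unitfE; apply/prodf_neq0 => i _.
have us : diag_mx s \in unitmx by apply: ud => i; rewrite mxE sgr_eq0.
have up : diag_mx p \in unitmx by apply: ud => i; rewrite mxE normr_eq0.
rewrite dsp lin_ratioM// lin_ratio_sqr1//; last first.
  rewrite mulmx_diag -diag_const_mx; congr diag_mx; apply/rowP => i.
  by rewrite !mxE -expr2 sqr_sg d0.
rewrite mul1e lin_ratio_unit_box//.
rewrite (_ : [set x | _] = box (const_mx 0) (\row_i `|d 0 i|^-1)).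
  rewrite lebesgue3_box => [|i]; last by rewrite !mxE invr_ge0.
  congr EFin; rewrite normr_prod -prodfV; apply: eq_bigr => i _.
  by rewrite !mxE subr0.
apply/seteqP; split => x xd i; have := xd i;
  have di : 0 < `|d 0 i| by rewrite normr_gt0.
  by rewrite mul_mx_diag !mxE pmulr_lge0// -ltr_pdivlMr// mul1r.
by rewrite mul_mx_diag !mxE pmulr_lge0// -ltr_pdivlMr// mul1r.
Qed.

Definition transvection (i j : 'I_3) (a : R) : 'M[R]_3 := 1%:M + a *: delta_mx i j.

Lemma transvectionM i j a b : i != j ->
  transvection i j a *m transvection i j b = transvection i j (a + b).
Proof.
move=> ij; rewrite /transvection mulmxDl mul1mx mulmxDr mulmx1.
rewrite -scalemxAl -scalemxAr mul_delta_mx_0 1?eq_sym// !scaler0 addr0.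
by rewrite -addrA -scalerDl (addrC b).
Qed.

Lemma unit_transvection i j a : i != j -> transvection i j a \in unitmx.
Proof.
move=> ij; suff: transvection i j a *m transvection i j (- a) = 1%:M.
  by case/mulmx1_unit.
by rewrite transvectionM// subrr /transvection scale0r addr0.
Qed.

(** Conjugation by the diagonal matrix that doubles the coordinate j turns the
    transvection into its square; hence its ratio is equal to its own square. *)
Lemma lin_ratio_transvection i j a : i != j -> c (transvection i j a) = 1%E.
Proof.
move=> ij; have uT b := unit_transvection b ij.
pose d : V := \row_k if k == j then 2 else 1.
have ud : diag_mx d \in unitmx.
  rewrite unitmxE det_diag unitfE; apply/prodf_neq0 => k _; rewrite mxE.
  by case: ifP => _; rewrite ?oner_eq0 ?pnatr_eq0.
have : transvection i j a *m diag_mx d = diag_mx d *m (transvection i j a *m transvection i j a).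
  rewrite transvectionM// mul_mx_diag mul_diag_mx; apply/matrixP => k l.
  rewrite !mxE; have [->|kj] := eqVneq k j.
    by rewrite (negPf (_ : j != i)) ?(eq_sym j)//= !mulr0 !addr0 eq_sym;
      case: eqP => // _; rewrite ?mul1r ?mulr1 ?mul0r ?mulr0.
  have [->|lj] := eqVneq l j.
    rewrite (negPf kj) !add0r mul1r andbT; case: eqP => _.
      by rewrite mulr1 mulr1 mulr2n mulrDr mulr1.
    by rewrite !mulr0 mul0r.
  by rewrite andbF !mulr0 !addr0 mulr1 mul1r.
move=> /(congr1 c); rewrite !lin_ratioM ?unitmx_mul ?uT//.
have [k k0 ->] := lin_ratio_fin ud.
have [l l0 ->] := lin_ratio_fin (uT a).
rewrite -!EFinM => -[]; rewrite mulrC => /(mulfI (lt0r_neq0 k0)) => ll.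
congr EFin; apply: (mulfI (lt0r_neq0 l0)); rewrite mulr1; exact/esym.
Qed.

End linear.

Section lineardet.
Context {R : realType}.
Local Notation V := 'rV[R]_3.
Local Notation mu := (@lebesgue3 R).
Local Notation c := (@lin_ratio R).

Lemma lin_ratio_lower (L : 'M[R]_3) :
  (forall i j : 'I_3, (i <= j)%N -> L i j = (i == j)%:R) -> c L = 1%E.
Proof.
move=> Ll.
rewrite (_ : L = transvection o1 o0 (L o1 o0) *m
  (transvection o2 o0 (L o2 o0) *m transvection o2 o1 (L o2 o1))).
  by rewrite !lin_ratioM ?unitmx_mul ?unit_transvection// !lin_ratio_transvection// !mule1.
have L00 : L o0 o0 = 1 by rewrite Ll.
have L11 : L o1 o1 = 1 by rewrite Ll.
have L22 : L o2 o2 = 1 by rewrite Ll.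
have L01 : L o0 o1 = 0 by rewrite Ll.
have L02 : L o0 o2 = 0 by rewrite Ll.
have L12 : L o1 o2 = 0 by rewrite Ll.
apply/matrixP; elim/ord3_ind; elim/ord3_ind; rewrite !mxE !sum_ord3 !mxE !sum_ord3 !mxE/=;
  rewrite ?(L00, L11, L22, L01, L02, L12); ring.
Qed.

Lemma lin_ratio_upper (U : 'M[R]_3) : (forall i, U i i != 0) ->
  (forall i j : 'I_3, (j < i)%N -> U i j = 0) ->
  c U = (`|\prod_i U i i|^-1)%:E.
Proof.
move=> Ud Uu.
pose d := \row_i U i i.
have ud : diag_mx d \in unitmx.
  by rewrite unitmxE det_diag unitfE; apply/prodf_neq0 => i _; rewrite mxE.
rewrite [in LHS](_ : U = diag_mx d *m (transvection o1 o2 (U o1 o2 / U o1 o1) *m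
  (transvection o0 o2 (U o0 o2 / U o0 o0) *m
   transvection o0 o1 (U o0 o1 / U o0 o0)))); last first.
  have U10 : U o1 o0 = 0 by rewrite Uu.
  have U20 : U o2 o0 = 0 by rewrite Uu.
  have U21 : U o2 o1 = 0 by rewrite Uu.
  rewrite mul_diag_mx; apply/matrixP; elim/ord3_ind; elim/ord3_ind;
    rewrite !mxE !sum_ord3 !mxE !sum_ord3 !mxE/= ?(U10, U20, U21); by field; rewrite ?Ud.
rewrite !lin_ratioM ?unitmx_mul ?unit_transvection//.
rewrite !lin_ratio_transvection// !mule1 lin_ratio_diag; last first.
  by move=> i; rewrite mxE.
by under eq_bigr do rewrite mxE.
Qed.

Let lupE n (A : 'M[R]_n.+1) :
  (cormen_lup A).1.1 *m A = (cormen_lup A).1.2 *m (cormen_lup A).2.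
Proof. by have := cormen_lup_correct A; case: (cormen_lup A) => [[]]. Qed.

(** By the LUP decomposition every invertible matrix is a product of a
    permutation, transvections and a diagonal matrix. *)
Lemma lin_ratioE (P : 'M[R]_3) : P \in unitmx -> c P = (`|\det P|^-1)%:E.
Proof.
move=> uP.
have := lupE P.
have /is_perm_mxP[s ->] := cormen_lup_perm P.
have := @cormen_lup_lower _ _ P; have := @cormen_lup_upper _ _ P.
have := cormen_lup_detL P.
move: (cormen_lup P).1.2 (cormen_lup P).2 => L U detL Uu Ll PLU.
have detU : \det U = \prod_i U i i.
  rewrite -det_tr det_trig; first by apply: eq_bigr => i _; rewrite mxE.
  by apply/is_trig_mxP => i j ij; rewrite mxE Uu.
have uL : L \in unitmx by rewrite unitmxE detL unitr1.
have uU : U \in unitmx.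
  have : L *m U \in unitmx by rewrite -PLU unitmx_mul unitmx_perm.
  by rewrite unitmx_mul => /andP[].
have Ud i : U i i != 0.
  by move: uU; rewrite unitmxE unitfE detU => /prodf_neq0/(_ i isT).
have e1 : c (perm_mx s *m P) = c P.
  by apply: (etrans (lin_ratioM (unitmx_perm _ s) uP)); rewrite lin_ratio_perm mul1e.
have e2 : c (L *m U) = (`|\det U|^-1)%:E.
  apply: (etrans (lin_ratioM uL uU)).
  by rewrite (lin_ratio_lower Ll) mul1e (lin_ratio_upper Ud Uu) -detU.
rewrite -e1 PLU e2.
congr (_%:E); congr (_^-1).
have := congr1 (fun A => `|\det A|) PLU.
by rewrite !det_mulmx det_perm !normrM normrX normrN1 expr1n detL mul1r normr1 mul1r.
Qed.

Theorem lebesgue3_linear (P : 'M[R]_3) (B : set V) : P \in unitmx ->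
  measurable B -> mu [set x | B (x *m P)] = ((`|\det P|^-1)%:E * mu B)%E.
Proof. by move=> uP mB; rewrite -lin_ratioE//; exact: lebesgue3_linear_proportional. Qed.

End lineardet.

(** * Induction on boxes by bisection *)

Section cousin.
Context {R : realType}.
Local Notation V := 'rV[R]_3.

Definition upd (v : V) (i : 'I_3) (m : R) : V :=
  \row_j if j == i then m else v 0 j.

Section box_induction.
Variables (good : V -> V -> Prop) (a0 b0 : V).
Hypothesis ab0 : forall i, a0 0 i <= b0 0 i.
Hypothesis good_split : forall (a b : V) i,
  let m := (a 0 i + b 0 i) / 2 in
  (forall i, a0 0 i <= a 0 i) -> (forall i, a 0 i <= b 0 i) ->
  (forall i, b 0 i <= b0 0 i) ->
  good a (upd b i m) -> good (upd a i m) b -> good a b.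
Hypothesis good_local : forall x, cbox a0 b0 x -> exists N : nat,
  forall (a b : V) n, (N <= n)%N ->
  (forall i, a0 0 i <= a 0 i) -> (forall i, b 0 i <= b0 0 i) ->
  cbox a b x -> (forall i, b 0 i - a 0 i = (b0 0 i - a0 0 i) / 2 ^+ n) ->
  good a b.

Let sub (p q : V * V) := forall i, p.1 0 i <= q.1 0 i <= q.2 0 i /\ q.2 0 i <= p.2 0 i.

(* Induction on the number k of sides that have been halved already. *)
Let half_step (k : nat) (p : V * V) : (k <= 3)%N ->
  (forall i, a0 0 i <= p.1 0 i) -> (forall i, p.1 0 i <= p.2 0 i) ->
  (forall i, p.2 0 i <= b0 0 i) -> ~ good p.1 p.2 ->
  exists q, [/\ sub p q, ~ good q.1 q.2 &
    forall i, q.2 0 i - q.1 0 i =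
      if (i < k)%N then (p.2 0 i - p.1 0 i) / 2 else p.2 0 i - p.1 0 i].
Proof.
move=> + ap pp pb gp; elim: k => [_|k IH k3].
  by exists p; split => // i; rewrite lexx pp lexx.
have [q [pq gq qw]] := IH (ltnW k3).
pose i : 'I_3 := Ordinal k3; pose m := (q.1 0 i + q.2 0 i) / 2.
have qq j : q.1 0 j <= q.2 0 j by have [/andP[]] := pq j.
have q1m : q.1 0 i <= m <= q.2 0 i.
  rewrite /m ler_pdivlMr// ler_pdivrMr// !mulr_natr !mulr2n.
  by rewrite lerD2l lerD2r qq.
have [gl|gl] := pselect (good q.1 (upd q.2 i m)).
  exists (upd q.1 i m, q.2); split => /=.
  - move=> j; rewrite !mxE; have [/andP[pqj _] qpj] := pq j.
    case: eqP => [->|_]; rewrite ?pqj ?qq ?qpj//.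
    have [/andP[pqi _] qpi] := pq i.
    by case/andP: q1m => m1 ->; rewrite (le_trans pqi m1).
  - move=> gr; apply: gq; apply: (good_split (i := i)) => //.
    + by move=> j; apply: le_trans (ap j) _; have [/andP[]] := pq j.
    + by move=> j; apply: le_trans (pb j); have [] := pq j.
  - move=> j; rewrite !mxE -val_eqE/= ltnS leq_eqVlt.
    have := qw j; have [jk|jk]/= := eqVneq (val j) k.
      have -> : j = i by exact: val_inj.
      rewrite /= ltnn => <-; rewrite /m; lra.
    by move=> ->.
exists (q.1, upd q.2 i m); split => //=.
- move=> j; rewrite !mxE; have [/andP[pqj _] qpj] := pq j.
  rewrite pqj/=; case: eqP => [->|_]; last by rewrite qq qpj.
  have [/andP[pqi _] qpi] := pq i.
  by case/andP: q1m => -> m2; rewrite (le_trans m2 qpi).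
- move=> j; rewrite !mxE -val_eqE/= ltnS leq_eqVlt.
  have := qw j; have [jk|jk]/= := eqVneq (val j) k.
    have -> : j = i by exact: val_inj.
    rewrite /= ltnn => <-; rewrite /m; lra.
  by move=> ->.
Qed.

Let bad (p : V * V) := [/\ forall i, a0 0 i <= p.1 0 i,
  forall i, p.1 0 i <= p.2 0 i, forall i, p.2 0 i <= b0 0 i & ~ good p.1 p.2].

Let next (p : V * V) : V * V := xget p [set q | [/\ sub p q, bad q &
    forall i, q.2 0 i - q.1 0 i = (p.2 0 i - p.1 0 i) / 2]].

Let nextP p : bad p -> [/\ sub p (next p), bad (next p) &
    forall i, (next p).2 0 i - (next p).1 0 i = (p.2 0 i - p.1 0 i) / 2].
Proof.
move=> [ap pp pb gp]; rewrite /next; case: xgetP => [q _ //|nq].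
have [q [pq gq qw]] := half_step (leqnn 3) ap pp pb gp.
exfalso; apply: (nq q); split => //; last by move=> i; rewrite qw ltn_ord.
split => // i; have [/andP[pq1 pq2] pq3] := pq i => //.
- exact: le_trans pq1.
- exact: le_trans (pb i).
Qed.

(** Cousin's lemma. If the box were not good, halving its sides in turn would
    produce a nested sequence of boxes that are not good either, and the
    suprema of their lower corners are the coordinates of a point that lies in
    all their closures; the local hypothesis fails there. All these boxes have
    the proportions of the first one, so their diameters stay comparable with
    their shortest sides, which the volume estimates rely on. *)
Theorem box_induction : good a0 b0.
Proof.
apply: contrapT => g0.
pose s n := iter n next (a0, b0).
have bs n : bad (s n).
  by elim: n => [|n IH]; [split|have [] := nextP IH].
have nds1 i : {homo (fun n => (s n).1 0 i) : m n / (m <= n)%N >-> m <= n}.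
  apply: homo_leq => // [|n]; first exact: le_trans.
  by have [/(_ i)[/andP[]]] := nextP (bs n).
have nds2 i : {homo (fun n => (s n).2 0 i) : m n / (m <= n)%N >-> n <= m}.
  apply: (homo_leq (r := fun x y => y <= x)) => // [x y z|n].
    by move=> yx zy; exact: le_trans yx.
  by have [/(_ i)[_]] := nextP (bs n).
have s12 i m n : (s m).1 0 i <= (s n).2 0 i.
  have [_ /(_ i) h _ _] := bs (maxn m n).
  apply: le_trans (nds1 i _ _ (leq_maxl m n)) _.
  by apply: le_trans h _; apply: nds2; exact: leq_maxr.
pose x : V := \row_i sup (range (fun n => (s n).1 0 i)).
have hs i : has_sup (range (fun n => (s n).1 0 i)).
  split; first by exists ((s 0%N).1 0 i), 0%N.
  by exists ((s 0%N).2 0 i) => _ [n _ <-].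
have xs n : cbox (s n).1 (s n).2 x.
  move=> i; rewrite mxE; apply/andP; split.
    by apply: ub_le_sup; [have [] := hs i|exists n].
  by apply: ge_sup; [have [] := hs i|move=> _ [m _ <-]].
have [N gN] := good_local (xs 0%N).
have [aN _ bN gsN] := bs N; apply: gsN.
apply: (gN _ _ N) => //.
move=> i; elim: (N) => [|n IH]; first by rewrite expr0 divr1.
have [_ _ /(_ i) ->] := nextP (bs n).
by rewrite IH exprSr invfM mulrA.
Qed.

End box_induction.
End cousin.

(** * Differentiable maps and their Jacobian matrices *)

Section local_estimates.
Context {R : realType}.
Local Notation V := 'rV[R]_3.
Local Notation mu := (@lebesgue3 R).

Lemma coord_le_norm (v : V) i : `|v 0 i| <= `|v|.
Proof.
rewrite [leRHS]/Num.norm/= mx_normrE; apply/bigmax_geP; right => /=.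
by exists (ord0, i).
Qed.

Lemma norm_le_coord (v : V) (r : R) : 0 <= r -> (forall i, `|v 0 i| <= r) -> `|v| <= r.
Proof.
move=> r0 vr; rewrite [leLHS]/Num.norm/= mx_normrE; apply/bigmax_leP; split => // -[i j] _ /=.
by rewrite ord1.
Qed.

(** A bound for the operator norm of P with respect to the maximum norm; the
    summand 1 makes it positive. *)
Definition mxsum (P : 'M[R]_3) : R := 1 + \sum_i \sum_j `|P i j|.

Lemma mxsum_gt0 P : 0 < mxsum P.
Proof. by rewrite ltr_pwDl// sumr_ge0// => i _; rewrite sumr_ge0. Qed.

Lemma norm_mulmx_le (v : V) (P : 'M[R]_3) : `|v *m P| <= `|v| * mxsum P.
Proof.
apply: norm_le_coord; first by rewrite mulr_ge0// ltW// mxsum_gt0.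
move=> j; rewrite mxE mulrDr mulr1 (le_trans (ler_norm_sum _ _ _))//.
rewrite -[leLHS]add0r lerD// mulr_sumr ler_sum// => i _.
rewrite normrM mulr_sumr (bigD1 j)//= -[leLHS]addr0 lerD//.
  by rewrite ler_wpM2r// coord_le_norm.
by rewrite sumr_ge0// => k _; rewrite mulr_ge0.
Qed.

Lemma diff_approx (F : V -> V) (x : V) (e : R) : differentiable F x -> 0 < e ->
  exists2 d : R, 0 < d & forall z, `|z - x| < d ->
    `|F z - F x - (z - x) *m 'J F x| <= e * `|z - x|.
Proof.
move=> dF e0; have /eqaddoP/(_ e e0) := diff_locally dF.
move=> /nbhs_normP[d/= d0 H]; exists d => // z zx.
have := H (z - x); rewrite /ball_/= sub0r normrN => /(_ zx).
by rewrite !fctE/= subrK /jacobian mul_rV_lin1/= opprD addrA.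
Qed.

(** G composed with F is the identity near x, so that its derivative along any
    v is the limit of a quotient that is eventually equal to v. *)
Lemma jacobianK (A : set V) (F G : V -> V) (x : V) : open A -> A x ->
  (forall z, A z -> G (F z) = z) ->
  differentiable F x -> differentiable G (F x) ->
  'J F x *m 'J G (F x) = 1%:M.
Proof.
move=> oA Ax GF dF dG.
have dGF : differentiable (G \o F) x by exact: differentiable_comp.
suff H (v : V) : v *m ('J F x *m 'J G (F x)) = v.
  by apply/row_matrixP => i; rewrite rowE H rowE mulmx1.
rewrite mulmxA -[v *m 'J F x]deriveEjacobian// deriveE//.
rewrite -deriveEjacobian// deriveE//.
have := diff_comp dF dG; move/(congr1 (fun f => f v)) => /= <-.
rewrite -deriveE//; apply: cvg_lim => //; apply: cvg_near_cst.
have xA : \forall h \near (0 : R), A (h *: v + x).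
  have /(_ A) : (fun h : R => h *: v + x) @ (0 : R) --> (0 : R) *: v + x.
    by apply: cvgD; [apply: cvgZr_tmp; exact: cvg_id|exact: cvg_cst].
  by rewrite scale0r add0r; apply; exact: open_nbhs_nbhs.
near=> h.
have h0 : h != 0 by near: h; exact: nbhs_dnbhs_neq.
rewrite /= !GF//.
  by rewrite addrK scalerA mulVf// scale1r.
near: h; apply: nbhs_dnbhs; exact: xA.
Unshelve. all: by end_near. Qed.

End local_estimates.

(** * The volume of the image of a small box *)

Section local_measure.
Context {R : realType}.
Local Notation V := 'rV[R]_3.
Local Notation mu := (@lebesgue3 R).

Lemma lebesgue3_affine_box (P : 'M[R]_3) (v a b : V) : P \in unitmx ->
  (forall i, a 0 i <= b 0 i) ->
  mu [set y | box a b (y *m P + v)] =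
    (`|\det P|^-1 * \prod_i (b 0 i - a 0 i))%:E.
Proof.
move=> uP ab.
have mB := measurable_box a b.
have mv : measurable [set z | box a b (z + v)].
  rewrite -[X in measurable X]setTI.
  exact: (@measurable_translation R v measurableT (box a b)).
rewrite (lebesgue3_linear uP mv) EFinM; congr (_ * _)%E.
by rewrite lebesgue3_translation// lebesgue3_box.
Qed.

Lemma measurable_affine_box (P : 'M[R]_3) (v a b : V) :
  measurable [set y | box a b (y *m P + v)].
Proof.
apply: (@measurable_lin_preimage R P [set z | box a b (z + v)]).
rewrite -[X in measurable X]setTI.
by apply: (@measurable_translation R v measurableT (box a b)); exact: measurable_box.
Qed.

(** The box with the same centre whose sides are 1 + 2 t times as long; t is
    negative when the box is shrunk. *)
Definition inflate (t : R) (a b : V) : set V :=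
  box (a - t *: (b - a)) (b + t *: (b - a)).

Lemma inflate_prod t (a b : V) :
  \prod_i ((b + t *: (b - a)) 0 i - (a - t *: (b - a)) 0 i) =
  (1 + 2 * t) ^+ 3 * \prod_i (b 0 i - a 0 i).
Proof.
transitivity (\prod_(i < 3) ((1 + 2 * t) * (b 0 i - a 0 i))).
  by apply: eq_bigr => i _; rewrite !mxE; ring.
by rewrite big_split/= prodr_const card_ord.
Qed.

Lemma inflate_perturb (t : R) (a b z r : V) : box a b z ->
  (forall i, `|r 0 i| <= t * (b 0 i - a 0 i)) -> inflate t a b (z + r).
Proof.
move=> abz rt i; rewrite !mxE; have /andP[az zb] := abz i.
have := rt i; rewrite ler_norml => /andP[r1 r2].
by apply/andP; split; lra.
Qed.

Lemma deflate_perturb (t : R) (a b z r : V) : inflate (- t) a b z ->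
  (forall i, `|r 0 i| <= t * (b 0 i - a 0 i)) -> box a b (z + r).
Proof.
move=> abz rt i; have := abz i; rewrite !mxE => /andP[az zb].
have := rt i; rewrite ler_norml => /andP[r1 r2].
by apply/andP; split; lra.
Qed.

Lemma norm_cbox (a b x z : V) (r : R) : cbox a b x -> cbox a b z -> 0 <= r ->
  (forall i, b 0 i - a 0 i <= r) -> `|z - x| <= r.
Proof.
move=> abx abz r0 ba; apply: norm_le_coord => // i; rewrite !mxE.
have /andP[? ?] := abx i; have /andP[? ?] := abz i; have := ba i.
by move=> ?; rewrite ler_norml; apply/andP; split; lra.
Qed.

Lemma exists_pow2 (M d : R) : 0 <= M -> 0 < d ->
  exists N : nat, forall n, (N <= n)%N -> M / 2 ^+ n < d.
Proof.
move=> M0 d0; exists (Num.truncn (M / d)).+1 => n Nn.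
rewrite ltr_pdivrMr ?exprn_gt0// mulrC -ltr_pdivrMr//.
apply: lt_le_trans (truncnS_gt _) _.
by rewrite -natrX ler_nat (leq_trans Nn)// ltnW// ltn_expl.
Qed.

Lemma width_bounds (w : V) : (forall i, 0 < w 0 i) ->
  exists m M : R, [/\ 0 < m, 0 < M & forall i, m <= w 0 i <= M].
Proof.
move=> w0; exists (\sum_i (w 0 i)^-1)^-1, (\sum_i w 0 i).
have pos (f : 'I_3 -> R) i : (forall i, 0 < f i) -> f i <= \sum_i f i.
  by move=> f0; rewrite (bigD1 i)//= lerDl sumr_ge0// => j _; exact: ltW.
have wV i : 0 < (w 0 i)^-1 by rewrite invr_gt0.
have s0 : 0 < \sum_i (w 0 i)^-1 by exact: lt_le_trans (wV 0) (pos _ 0 wV).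
split; [by rewrite invr_gt0|exact: lt_le_trans (w0 0) (pos _ 0 w0)|move=> i].
rewrite (pos (fun i => w 0 i))// andbT -[leRHS]invrK lef_pV2 ?posrE//.
exact: pos.
Qed.

(** A volume below k leaves room for a small inflation; as (1 + s / 14) ^ 3 is
    at most 1 + s on [0, 1], a margin proportional to k - d is enough. *)
Lemma cube_margin_up (d k : R) : 0 <= d -> d < k ->
  exists2 t : R, 0 < t & d * (1 + 2 * t) ^+ 3 <= k.
Proof.
move=> d0 dk.
exists (Num.min 1 ((k - d) / (d + 1)) / 14 / 2).
  by rewrite !divr_gt0// lt_min ltr01 divr_gt0// ?subr_gt0//; lra.
set s := Num.min _ _.
have s1 : s <= 1 by rewrite /s ge_min lexx.
have s0 : 0 < s by rewrite lt_min ltr01 divr_gt0// ?subr_gt0//; lra.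
have sd : s * d <= k - d.
  have : s <= (k - d) / (d + 1) by rewrite /s ge_min lexx orbT.
  rewrite ler_pdivlMr; last lra.
  by apply: le_trans; rewrite ler_wpM2l ?ltW//; lra.
have sss : s ^+ 3 <= s by rewrite exprS ler_piMr ?exprn_ile1 ?(ltW s0).
have ss : s ^+ 2 <= s by rewrite expr2 ler_piMr ?(ltW s0).
have : (1 + 2 * (s / 14 / 2)) ^+ 3 <= 1 + s.
  rewrite (_ : 2 * _ = s / 14); last by field.
  rewrite (_ : _ ^+ 3 = 1 + 3 / 14 * s + 3 / 196 * s ^+ 2 + s ^+ 3 / 2744); last by field.
  lra.
move=> H; apply: le_trans (ler_wpM2l d0 H) _.
by rewrite mulrDr mulr1 [d * s]mulrC -lerBrDl.
Qed.

(** Bernoulli's inequality (1 - 2 t) ^ 3 >= 1 - 6 t dictates the margin. *)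
Lemma cube_margin_down (d k : R) : 0 <= k -> k < d ->
  exists2 t : R, 0 < t < 1 / 2 & k <= d * (1 - 2 * t) ^+ 3.
Proof.
move=> k0 kd; have d0 : 0 < d by exact: le_lt_trans kd.
exists ((d - k) / (6 * d)).
  apply/andP; split; first by rewrite divr_gt0// ?subr_gt0// mulr_gt0.
  by rewrite ltr_pdivrMr ?mulr_gt0//; lra.
set t := _ / _.
have t0 : 0 < t by rewrite divr_gt0// ?subr_gt0// mulr_gt0.
have td : t * (6 * d) = d - k by rewrite /t mulfVK// gt_eqF// mulr_gt0.
have t6 : 6 * t <= 1 by rewrite -(ler_pM2r d0) mul1r; lra.
have : 1 - 6 * t <= (1 - 2 * t) ^+ 3.
  rewrite (_ : _ ^+ 3 = 1 - 6 * t + 4 * t ^+ 2 * (3 - 2 * t)); last ring.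
  rewrite lerDl mulr_ge0//; last lra.
  by rewrite mulr_ge0// sqr_ge0.
move=> H; apply: le_trans (ler_wpM2l (ltW d0) H).
lra.
Qed.

Section upper.
Variables (B : set V) (F G : V -> V) (x0 w : V) (k : R).
Hypothesis w0 : forall i, 0 < w 0 i.
Hypothesis dF : differentiable F x0.
Hypothesis uJ : 'J F x0 \in unitmx.
Hypothesis mG : forall a b, measurable (B `&` G @^-1` box a b).
Hypothesis FG : forall y, B y -> F (G y) = y.

(** Let J be the Jacobian matrix at x0. On a box of diameter of order 2 ^- n
    near x0, F differs from its affine approximation by a small multiple of
    2 ^- n. Pulled back by the affine approximation, the image of the box
    therefore lies in a slightly inflated box, and the affine map multiplies
    volumes by the absolute value of det J. *)
Lemma local_upper : `|\det ('J F x0)| < k -> exists N : nat,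
  forall (a b : V) n, (N <= n)%N -> cbox a b x0 ->
  (forall i, b 0 i - a 0 i = w 0 i / 2 ^+ n) ->
  (mu (B `&` G @^-1` box a b) <= (k * \prod_i (b 0 i - a 0 i))%:E)%E.
Proof.
move=> Jk.
have [t t0 tk] := cube_margin_up (normr_ge0 _) Jk.
have [m [M [m0 M0 mwM]]] := width_bounds w0.
move: dF uJ => dF' uJ'; set J := 'J F x0 in uJ' Jk tk *; pose P := invmx J; pose K := mxsum P.
have K0 : 0 < K by exact: mxsum_gt0.
(* With this relative error the deviation, once multiplied by the inverse of J,
   is at most t times the shortest side of the box. *)
pose e := t * m / (K * M).
have e0 : 0 < e by rewrite divr_gt0// mulr_gt0.
have [d d0 Fd] := diff_approx dF' e0.
have [N dN] := exists_pow2 (ltW M0) d0.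
exists N => a b n Nn abx wab.
have n0 : 0 < 2 ^+ n :> R by rewrite exprn_gt0.
have wn i : b 0 i - a 0 i <= M / 2 ^+ n.
  by rewrite wab ler_pM2r ?invr_gt0//; have /andP[] := mwM i.
have ab i : a 0 i <= b 0 i by rewrite -subr_ge0 wab divr_ge0// ltW.
pose v := x0 - F x0 *m P.
apply: (@le_trans _ _ (mu [set y | inflate t a b (y *m P + v)])).
  apply: le_measure; rewrite ?inE; [exact: mG|exact: measurable_affine_box|].
  move=> y [By /= Gy]; set z := G y in Gy.
  have Fz : F z = y by exact: FG.
  pose r := F z - F x0 - (z - x0) *m J.
  have zx : `|z - x0| <= M / 2 ^+ n.
    apply: (norm_cbox abx) => //; first exact: box_sub_cbox.
    by rewrite divr_ge0// ltW.
  have -> : y *m P + v = z + r *m P.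
    rewrite /v /r Fz !mulmxBl -!mulmxA mulmxV// !mulmx1.
    by rewrite opprB; apply/rowP => i; rewrite !mxE; ring.
  apply: inflate_perturb => // i.
  apply: le_trans (coord_le_norm _ _) _.
  apply: le_trans (norm_mulmx_le _ _) _; rewrite -/K.
  apply: (@le_trans _ _ (e * (M / 2 ^+ n) * K)).
    rewrite (ler_wpM2r (ltW K0))//; apply: le_trans (Fd _ _) _.
      exact: le_lt_trans zx (dN n Nn).
    by rewrite (ler_wpM2l (ltW e0)).
  rewrite wab (_ : e * _ * K = t * (m / 2 ^+ n)).
    rewrite (ler_wpM2l (ltW t0))// ler_pM2r ?invr_gt0//.
    by have /andP[] := mwM i.
  by rewrite /e; field; rewrite ?gt_eqF.
rewrite lebesgue3_affine_box ?unitmx_inv//; last first.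
  move=> i; rewrite !mxE; have := ab i; rewrite -subr_ge0 => h.
  by nra.
rewrite inflate_prod lee_fin det_inv normfV invrK mulrA ler_wpM2r//.
by apply: prodr_ge0 => i _; rewrite subr_ge0.
Qed.

End upper.

Section lower.
Variables (B : set V) (G : V -> V) (y0 w : V) (k : R).
Hypothesis w0 : forall i, 0 < w 0 i.
Hypothesis oB : open B.
Hypothesis By0 : B y0.
Hypothesis dG : differentiable G y0.
Hypothesis uP : 'J G y0 \in unitmx.
Hypothesis mG : forall a b, measurable (B `&` G @^-1` box a b).

(** The lower bound rests on the inverse map G, which is differentiable too.
    The affine approximation of G at y0 maps a set of known volume onto a
    slightly shrunk box, and the error is too small for G itself to leave the
    original box. Hence G maps that whole set into the box. *)
Lemma local_lower : 0 <= k -> k < `|\det ('J G y0)|^-1 -> exists N : nat,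
  forall (a b : V) n, (N <= n)%N -> cbox a b (G y0) ->
  (forall i, b 0 i - a 0 i = w 0 i / 2 ^+ n) ->
  ((k * \prod_i (b 0 i - a 0 i))%:E <= mu (B `&` G @^-1` box a b))%E.
Proof.
move=> k0 kP.
have [t /andP[t0 t12] tk] := cube_margin_down k0 kP.
have [m [M [m0 M0 mwM]]] := width_bounds w0.
move: dG uP => dG' uP'; set P := 'J G y0 in uP' kP tk *.
pose J := invmx P; pose K := mxsum J.
have K0 : 0 < K by exact: mxsum_gt0.
have MK0 : 0 < M * K by exact: mulr_gt0.
pose e := t * m / (M * K).
have e0 : 0 < e by rewrite divr_gt0// mulr_gt0.
have [d d0 Gd] := diff_approx dG' e0.
have /nbhs_normP[d'/= d'0 Bd'] : nbhs y0 B by exact: open_nbhs_nbhs.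
have dd0 : 0 < Num.min d d' by rewrite lt_min d0 d'0.
have [N dN] := exists_pow2 (ltW MK0) dd0.
set x0 := G y0 in Gd *.
exists N => a b n Nn abx wab.
have n0 : 0 < 2 ^+ n :> R by rewrite exprn_gt0.
have wn i : b 0 i - a 0 i <= M / 2 ^+ n.
  by rewrite wab ler_pM2r ?invr_gt0//; have /andP[] := mwM i.
have ab i : a 0 i <= b 0 i by rewrite -subr_ge0 wab divr_ge0// ltW.
pose v := x0 - y0 *m P.
apply: (@le_trans _ _ (mu [set y | inflate (- t) a b (y *m P + v)])); last first.
  apply: le_measure; rewrite ?inE; [exact: measurable_affine_box|exact: mG|].
  move=> y; set z := y *m P + v => /= zab.
  have zx : `|z - x0| <= M / 2 ^+ n.
    apply: (norm_cbox abx) => //; last by rewrite divr_ge0// ltW.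
    apply: box_sub_cbox; rewrite -[z]addr0; apply: (deflate_perturb zab) => i.
    by rewrite mxE normr0 mulr_ge0 ?subr_ge0// ltW.
  have yz : y - y0 = (z - x0) *m J.
    rewrite /z /v addrA addrAC addrK -mulmxBl -mulmxA mulmxV//.
    by rewrite mulmx1.
  have yy0 : `|y - y0| <= M * K / 2 ^+ n.
    rewrite yz; apply: le_trans (norm_mulmx_le _ _) _.
    by rewrite mulrAC (ler_wpM2r (ltW K0)).
  have : `|y - y0| < Num.min d d' by exact: le_lt_trans yy0 (dN n Nn).
  rewrite lt_min => /andP[yd yd']; split.
    by apply: Bd'; rewrite /ball_/= distrC.
  rewrite /preimage/=.
  pose r := G y - x0 - (y - y0) *m P.
  have -> : G y = z + r.
    by rewrite /r /z /v mulmxBl; apply/rowP => i; rewrite !mxE; ring.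
  apply: (deflate_perturb zab) => i.
  apply: le_trans (coord_le_norm _ _) _.
  apply: le_trans (Gd _ yd) _.
  apply: le_trans (ler_wpM2l (ltW e0) yy0) _.
  rewrite wab (_ : e * _ = t * (m / 2 ^+ n)).
    rewrite (ler_wpM2l (ltW t0))// ler_pM2r ?invr_gt0//.
    by have /andP[] := mwM i.
  by rewrite /e; field; rewrite ?gt_eqF.
rewrite lebesgue3_affine_box//; last first.
  move=> i; rewrite !mxE; have := ab i; rewrite -subr_ge0 => h.
  by nra.
rewrite inflate_prod lee_fin mulrA ler_wpM2r//; last by rewrite mulrN.
by apply: prodr_ge0 => i _; rewrite subr_ge0.
Qed.

End lower.
End local_measure.

(** * Measures with a density *)

Section density.
Context d (T : measurableType d) (R : realType).
Variables (mu : {measure set T -> \bar R}) (g : T -> R).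
Hypothesis mg : measurable_fun setT g.
Hypothesis g0 : forall x, 0 <= g x.

Definition density (A : set T) : \bar R := (\int[mu]_(x in A) (g x)%:E)%E.

Let density0 : density set0 = 0%E.
Proof. by rewrite /density integral_set0. Qed.

Let density_ge0 A : (0 <= density A)%E.
Proof. by apply: integral_ge0 => x _; rewrite lee_fin. Qed.

Let density_sigma_additive : semi_sigma_additive density.
Proof.
apply: semi_sigma_additive_nng_induced; first exact/measurable_EFinP.
by move=> x; rewrite lee_fin.
Qed.

HB.instance Definition _ := isMeasure.Build _ _ _ density
  density0 density_ge0 density_sigma_additive.

Definition density_measure : {measure set T -> \bar R} := density.

Import HBNNSimple.

Let integral_density_nnsfun (h : {nnsfun T >-> R}) :
  (\int[density_measure]_x (h x)%:E = \int[mu]_x (h x * g x)%:E)%E.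
Proof.
rewrite integralT_nnsfun sintegralE.
have mX r : measurable (h @^-1` [set r]) by [].
transitivity (\int[mu]_x \sum_(r \in range h)
    (r%:E * (\1_(h @^-1` [set r]) x * g x)%:E))%E; last first.
  apply: eq_integral => x _; rewrite [in RHS](fimfunE h).
  under eq_fsbigr do rewrite -EFinM mulrA.
  rewrite fsumEFin//; congr EFin.
  by rewrite !fsbig_finite//= mulr_suml.
transitivity (\sum_(r \in range h)
    \int[mu]_x ((Num.max 0 r)%:E * (\1_(h @^-1` [set r]) x * g x)%:E))%E.
  apply: eq_fsbigr => r; rewrite inE => -[x _ <-].
  have hx : 0 <= h x by [].
  rewrite max_r// ge0_integralZl_EFin//; last 2 first.
  - by move=> y _; rewrite lee_fin mulr_ge0// indicE ler0n.
  - by apply/measurable_EFinP; apply: measurable_funM => //; exact: measurable_indic.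
  rewrite /= /density; congr (_ * _)%E; rewrite integral_mkcond.
  apply: eq_integral => y _; rewrite patchE indicE.
  by case: ifPn => _; rewrite ?mul1r ?mul0r.
rewrite -ge0_integral_fsum//.
- apply: eq_integral => x _; apply: eq_fsbigr => r; rewrite inE => -[y _ <-].
  by rewrite max_r.
- move=> r; apply/measurable_EFinP; apply: measurable_funM => //.
  by apply: measurable_funM => //; exact: measurable_indic.
- by move=> r x _; rewrite -EFinM lee_fin mulr_ge0 ?le_max ?lexx// mulr_ge0.
Qed.

(** For simple functions this is the definition of the density; monotone
    convergence does the rest. *)
Lemma ge0_integral_density (f : T -> R) : measurable_fun setT f ->
  (forall x, 0 <= f x) ->
  (\int[density_measure]_x (f x)%:E = \int[mu]_x (f x * g x)%:E)%E.
Proof.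
move=> mf f0.
have mEf : measurable_fun setT (EFin \o f) by exact/measurable_EFinP.
pose h := nnsfun_approx measurableT mEf.
have h0 n x : 0 <= h n x by [].
have hf x : (h n x)%:E @[n --> \oo] --> (f x)%:E.
  by apply: (cvg_nnsfun_approx measurableT mEf) => // y _; rewrite lee_fin.
have hnd x : {homo (fun n => h n x) : m n / (m <= n)%N >-> m <= n}.
  by move=> m n mn; exact/lefP/nd_nnsfun_approx.
transitivity (limn (fun n => \int[density_measure]_x (h n x)%:E))%E.
  rewrite -monotone_convergence//.
  - by apply: eq_integral => x _; apply/esym/cvg_lim => //; exact: hf.
  - by move=> n; exact/measurable_EFinP.
  - by move=> n x _; rewrite lee_fin.
  - by move=> x _ m n mn; rewrite lee_fin hnd.
under eq_fun do rewrite integral_density_nnsfun.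
rewrite -monotone_convergence//.
- apply: eq_integral => x _; apply/cvg_lim => //.
  under eq_fun do rewrite EFinM.
  rewrite EFinM; apply: cvgeZr => //; exact: hf.
- by move=> n; apply/measurable_EFinP; exact: measurable_funM.
- by move=> n x _; rewrite lee_fin mulr_ge0.
- by move=> x _ m n mn; rewrite lee_fin ler_wpM2r// hnd.
Qed.

End density.

(** * The change of variables formula *)

Section box_split.
Context {R : realType}.
Local Notation V := 'rV[R]_3.

Lemma measure_box_split (m : {measure set V -> \bar R}) (a b : V) i (c : R) :
  a 0 i <= c <= b 0 i ->
  m (box a b) = (m (box a (upd b i c)) + m (box (upd a i c) b))%E.
Proof.
move=> /andP[ac cb]; rewrite -measureU; last 3 first.
- exact: measurable_box.
- exact: measurable_box.
- rewrite -subset0 => x [/(_ i) + /(_ i)].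
  by rewrite !mxE eqxx => /andP[_ xc] /andP[cx _]; have := lt_le_trans xc cx; rewrite ltxx.
congr (m _); apply/seteqP; split => [x xab|x [|] xab j].
- have [xc|cx] := ltP (x 0 i) c; [left|right] => j; have := xab j; rewrite mxE;
    by case: eqP => // -> /andP[xa xb]; apply/andP; split.
- have := xab j; rewrite mxE; case: eqP => // -> /andP[-> xc].
  exact: lt_le_trans cb.
- have := xab j; rewrite mxE; case: eqP => // -> /andP[cx ->].
  by rewrite (le_trans ac).
Qed.

Lemma measure_box_split_le (m1 m2 m3 : {measure set V -> \bar R}) (e : R)
    (a b : V) i (c : R) : a 0 i <= c <= b 0 i ->
  (m1 (box a (upd b i c)) <=
    m2 (box a (upd b i c)) + e%:E * m3 (box a (upd b i c)))%E ->
  (m1 (box (upd a i c) b) <=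
    m2 (box (upd a i c) b) + e%:E * m3 (box (upd a i c) b))%E ->
  (m1 (box a b) <= m2 (box a b) + e%:E * m3 (box a b))%E.
Proof.
move=> acb h1 h2; rewrite !(measure_box_split _ acb) ge0_muleDr//.
apply: le_trans (leeD h1 h2) _.
by rewrite addeACA.
Qed.

Lemma measure_box_split_lty (m : {measure set V -> \bar R}) (a b : V) i (c : R) :
  a 0 i <= c <= b 0 i ->
  (m (box a (upd b i c)) < +oo)%E -> (m (box (upd a i c) b) < +oo)%E ->
  (m (box a b) < +oo)%E.
Proof.
by move=> acb h1 h2; rewrite (measure_box_split _ acb) lte_add_pinfty.
Qed.

End box_split.

Lemma integral_mrestr d (T : measurableType d) (R : realType)
    (mu : {measure set T -> \bar R}) (D : set T) (mD : measurable D)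
    (f : T -> \bar R) : measurable_fun setT f -> (forall x, 0 <= f x)%E ->
  (\int[mrestr mu mD]_x f x = \int[mu]_(x in D) f x)%E.
Proof.
move=> mf f0.
have mDC : measurable (~` D) by exact: measurableC.
have off0 : (\int[mrestr mu mD]_(x in ~` D) f x = 0)%E.
  apply: null_set_integral => //; first exact: measurable_funTS.
  by rewrite /= /mrestr setICl measure0.
transitivity (\int[mrestr mu mD]_(x in D) f x)%E.
  rewrite -(setUv D) ge0_integral_setU//=; first by rewrite off0 adde0.
  - exact: measurable_funTS.
  - by apply/disj_setPS; rewrite setICr.
apply: eq_measure_integral => A mA AD.
by rewrite /= /mrestr (setIidl AD).
Qed.

Lemma continuous_det (R : realType) n : continuous (fun M : 'M[R]_n => \det M).
Proof.
rewrite /determinant; apply: continuous_big => [|s _].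
  by move=> x; exact: add_continuous.
have cP : continuous (fun M : 'M[R]_n => \prod_i M i (s i)).
  apply: continuous_big => [|i _]; first by move=> x; exact: mul_continuous.
  exact: coord_continuous.
by move=> M; apply: (continuous_comp (cP M)); exact: mulrl_continuous.
Qed.

Section change_of_variables.
Context {R : realType}.
Local Notation V := 'rV[R]_3.
Local Notation mu := (@lebesgue3 R).
Variables (A B : set V) (F G : V -> V).
Hypotheses (oA : open A) (oB : open B).
Hypotheses (C1F : C1_on A F) (dG : forall y, B y -> differentiable G y).
Hypotheses (FA : forall x, A x -> B (F x)) (GB : forall y, B y -> A (G y)).
Hypotheses (GF : forall x, A x -> G (F x) = x) (FG : forall y, B y -> F (G y) = y).

Let dF x : A x -> differentiable F x. Proof. by case: C1F => + _; exact. Qed.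

Let mA : measurable A. Proof. exact: open_measurable_rV. Qed.
Let mB : measurable B. Proof. exact: open_measurable_rV. Qed.

Let mG : measurable_fun B G.
Proof.
apply: measurable_fun_rV => i; apply: continuous_measurable_rV => //.
rewrite continuous_open_subspace// => y /[1!inE] By.
apply: (@cvg_comp _ _ _ G (fun M : V => M 0 i) _ (nbhs (G y))).
  exact: differentiable_continuous (dG By).
exact: coord_continuous.
Qed.

Lemma jacobian_unit x : A x -> 'J F x \in unitmx.
Proof.
move=> Ax; have JJ := jacobianK oA Ax GF (dF Ax) (dG (FA Ax)).
exact: (mulmx1_unit JJ).1.
Qed.

Lemma continuous_jacobian_det x : A x ->
  `|\det ('J F z)| @[z --> x] --> `|\det ('J F x)|.
Proof.
move=> Ax; have [_] := C1F; rewrite continuous_open_subspace// => /(_ x).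
rewrite inE => /(_ Ax) cJ.
apply: (@continuous_comp _ _ _ (jacobian F) (fun M : 'M[R]_3 => `|\det M|) x) => //.
apply: (@continuous_comp _ _ _ (fun M : 'M[R]_3 => \det M) Num.norm).
  exact: continuous_det.
exact: norm_continuous.
Qed.

Definition jac_density : V -> R := (fun x => `|\det ('J F x)|) \_ A.

Lemma jac_density_ge0 x : 0 <= jac_density x.
Proof. by rewrite /jac_density patchE; case: ifP. Qed.

Lemma measurable_jac_density :
  measurable_fun setT (jac_density : V -> measurableTypeR R).
Proof.
apply/(measurable_restrictT (fun x => `|\det ('J F x)|) mA).
apply: continuous_measurable_rV => //.
by rewrite continuous_open_subspace// => x /[1!inE]; exact: continuous_jacobian_det.
Qed.

(* A total measurable map is needed for the pushforward; the measure that is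
   pushed forward is restricted to B, where G' coincides with G. *)
Let G' : V -> V := G \_ B.

Let mG' : measurable_fun setT G'.
Proof. exact/(measurable_restrictT G mB). Qed.

Let im : {measure set V -> \bar R} := image_measure (mrestr mu mB) mG'.
Let nu : {measure set V -> \bar R} :=
  density_measure mu measurable_jac_density jac_density_ge0.

Let imE E : im E = mu (B `&` G @^-1` E).
Proof.
rewrite /im/= /pushforward /mrestr; congr (mu _).
apply/seteqP; split => [y [+ By]|y [By Ey]]; last split => //;
  rewrite /G'/preimage/= patchE mem_set//.
Qed.

Let mGE E : measurable E -> measurable (B `&` G @^-1` E).
Proof. by move=> mE; exact: mG. Qed.

Section on_box.
Variables (a b : V).
Hypothesis ab : forall i, a 0 i < b 0 i.
Hypothesis abA : cbox a b `<=` A.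
Let w : V := b - a.
Let w0 i : 0 < w 0 i. Proof. by rewrite !mxE subr_gt0. Qed.
Let wE i n : (b 0 i - a 0 i) / 2 ^+ n = w 0 i / 2 ^+ n. Proof. by rewrite !mxE. Qed.

(* Boxes with the proportions of [a, b[ shrink to the points that they touch. *)
Let close (x : V) (P : V -> Prop) : (\forall z \near x, P z) ->
  exists N, forall (c d : V) n, (N <= n)%N -> cbox c d x ->
    (forall i, d 0 i - c 0 i = w 0 i / 2 ^+ n) -> forall z, box c d z -> P z.
Proof.
move=> /nbhs_normP[e/= e0 xe].
have [m [M [m0 M0 mwM]]] := width_bounds w0.
have [N eN] := exists_pow2 (ltW M0) e0.
exists N => c d n Nn cdx wcd z cdz; apply: xe.
rewrite /ball_/= distrC; apply: le_lt_trans (eN n Nn).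
apply: (norm_cbox cdx) => //; first exact: box_sub_cbox.
  by rewrite divr_ge0// ltW.
by move=> i; rewrite wcd ler_pM2r ?invr_gt0 ?exprn_gt0//; have /andP[] := mwM i.
Qed.

Let mid (c d : V) i : (forall i, c 0 i <= d 0 i) ->
  c 0 i <= (c 0 i + d 0 i) / 2 <= d 0 i.
Proof. by move=> /(_ i) cd; apply/andP; split; lra. Qed.

Let mGbox c d : measurable (B `&` G @^-1` box c d).
Proof. by apply: mGE; exact: measurable_box. Qed.

Let im_local_upper x k : cbox a b x -> `|\det ('J F x)| < k -> exists N : nat,
  forall (c d : V) n, (N <= n)%N -> cbox c d x ->
  (forall i, d 0 i - c 0 i = w 0 i / 2 ^+ n) ->
  (im (box c d) <= k%:E * mu (box c d))%E.
Proof.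
move=> /abA Ax xk; have uJ := jacobian_unit Ax.
have [N HN] := local_upper w0 (dF Ax) uJ mGbox FG xk.
exists N => c d n Nn cdx wcd; rewrite imE lebesgue3_box; first exact: HN wcd.
by move=> i; rewrite -subr_ge0 wcd divr_ge0// ltW.
Qed.

Let im_local_lower x k : cbox a b x -> 0 <= k -> k < `|\det ('J F x)| ->
  exists N : nat, forall (c d : V) n, (N <= n)%N -> cbox c d x ->
  (forall i, d 0 i - c 0 i = w 0 i / 2 ^+ n) ->
  (k%:E * mu (box c d) <= im (box c d))%E.
Proof.
move=> /abA Ax k0 kx.
have JJ := jacobianK oA Ax GF (dF Ax) (dG (FA Ax)).
have uP := (mulmx1_unit JJ).2.
have kP : k < `|\det ('J G (F x))|^-1.
  have jp : \det ('J F x) * \det ('J G (F x)) = 1 by rewrite -det_mulmx JJ det1.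
  have p0 : \det ('J G (F x)) != 0 by move: uP; rewrite unitmxE unitfE.
  rewrite -normfV (_ : _^-1 = \det ('J F x))//.
  by apply: (mulIf p0); rewrite mulVf.
have [N HN] := local_lower w0 oB (FA Ax) (dG (FA Ax)) uP mGbox k0 kP.
exists N => c d n Nn cdx wcd; rewrite imE lebesgue3_box.
  by apply: HN wcd => //; rewrite GF.
by move=> i; rewrite -subr_ge0 wcd divr_ge0// ltW.
Qed.

Let im_box_lty : (im (box a b) < +oo)%E.
Proof.
apply: (@box_induction R (fun c d => (im (box c d) < +oo)%E) a b).
- by move=> i; exact: ltW.
- move=> c d i m _ cd _; exact: (measure_box_split_lty (mid i cd)).
- move=> x abx.
  have kx : `|\det ('J F x)| < `|\det ('J F x)| + 1 by rewrite ltrDl.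
  have [N HN] := im_local_upper abx kx.
  exists N => c d n Nn _ _ cdx wcd.
  have wcd' i : d 0 i - c 0 i = w 0 i / 2 ^+ n by rewrite wcd wE.
  apply: le_lt_trans (HN c d n Nn cdx wcd') _.
  rewrite lebesgue3_box ?ltry// => i.
  by rewrite -subr_ge0 wcd' divr_ge0// ltW.
Qed.

Let nu_le c d k : 0 <= k -> (forall z, box c d z -> jac_density z <= k) ->
  (nu (box c d) <= k%:E * mu (box c d))%E.
Proof.
move=> k0 Jk; rewrite /nu/= /density -(integral_cst mu (measurable_box c d)).
apply: ge0_le_integral => //.
- exact: measurable_box.
- by move=> z _; rewrite lee_fin jac_density_ge0.
- by apply/measurable_EFinP; apply: measurable_funTS; exact: measurable_jac_density.
Qed.

Let nu_ge c d k : 0 <= k -> (forall z, box c d z -> k <= jac_density z) ->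
  (k%:E * mu (box c d) <= nu (box c d))%E.
Proof.
move=> k0 Jk; rewrite /nu/= /density -(integral_cst mu (measurable_box c d)).
apply: ge0_le_integral => //.
- exact: measurable_box.
- by apply/measurable_EFinP; apply: measurable_funTS; exact: measurable_jac_density.
Qed.

Let jac_density_near x e : A x -> 0 < e -> \forall z \near x,
  `|\det ('J F x)| - e < jac_density z < `|\det ('J F x)| + e.
Proof.
move=> Ax e0; have AA : \forall z \near x, A z by exact: open_nbhs_nbhs.
have /cvgrPdist_lt/(_ e e0) := continuous_jacobian_det Ax.
apply: filterS2 AA => z Az.
by rewrite /jac_density patchE mem_set// ltr_distlC.
Qed.

(* By [box_induction]; the continuity of the Jacobian determinant compares its
   integral over a small box with its value at the limit point. *)
Let im_le_nu (e : R) : 0 < e ->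
  (im (box a b) <= nu (box a b) + e%:E * mu (box a b))%E.
Proof.
move=> e0; apply: (@box_induction R (fun c d =>
  (im (box c d) <= nu (box c d) + e%:E * mu (box c d))%E) a b).
- by move=> i; exact: ltW.
- move=> c d i m _ cd _; exact: (measure_box_split_le (mid i cd)).
- move=> x abx; have Ax := abA abx.
  set j := `|\det ('J F x)|.
  have e20 : 0 < e / 2 by rewrite divr_gt0.
  have jk : j < j + e / 2 by rewrite ltrDl.
  have [N1 HN1] := im_local_upper abx jk.
  have [N2 HN2] := close (jac_density_near Ax e20).
  exists (maxn N1 N2) => c d n; rewrite geq_max => /andP[n1 n2] _ _ cdx wcd.
  have wcd' i : d 0 i - c 0 i = w 0 i / 2 ^+ n by rewrite wcd wE.
  have Hj z : box c d z -> Num.max 0 (j - e / 2) <= jac_density z.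
    move=> cdz; rewrite ge_max jac_density_ge0/=.
    by have /andP[/ltW] := HN2 c d n n2 cdx wcd' z cdz.
  have k0 : 0 <= Num.max 0 (j - e / 2) by rewrite le_max lexx.
  apply: le_trans (HN1 c d n n1 cdx wcd') _.
  apply: le_trans (leeD2r _ (nu_ge k0 Hj)).
  rewrite -ge0_muleDl// ?lee_fin// ?(ltW e0)//.
  apply: lee_wpmul2r; first exact: measure_ge0.
  rewrite -EFinD lee_fin -lerBlDr le_max; apply/orP; right; lra.
Qed.

Let nu_le_im (e : R) : 0 < e ->
  (nu (box a b) <= im (box a b) + e%:E * mu (box a b))%E.
Proof.
move=> e0; apply: (@box_induction R (fun c d =>
  (nu (box c d) <= im (box c d) + e%:E * mu (box c d))%E) a b).
- by move=> i; exact: ltW.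
- move=> c d i m _ cd _; exact: (measure_box_split_le (mid i cd)).
- move=> x abx; have Ax := abA abx.
  have j0 : 0 < `|\det ('J F x)|.
    by rewrite normr_gt0 -unitfE -unitmxE; exact: jacobian_unit.
  set j := `|\det ('J F x)| in j0.
  have e20 : 0 < e / 2 by rewrite divr_gt0.
  have k0 : 0 <= Num.max 0 (j - e / 2) by rewrite le_max lexx.
  have kj : Num.max 0 (j - e / 2) < j by rewrite gt_max j0 ltrBlDr ltrDl.
  have [N1 HN1] := im_local_lower abx k0 kj.
  have [N2 HN2] := close (jac_density_near Ax e20).
  exists (maxn N1 N2) => c d n; rewrite geq_max => /andP[n1 n2] _ _ cdx wcd.
  have wcd' i : d 0 i - c 0 i = w 0 i / 2 ^+ n by rewrite wcd wE.
  have Hj z : box c d z -> jac_density z <= j + e / 2.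
    by move=> cdz; have /andP[_ /ltW] := HN2 c d n n2 cdx wcd' z cdz.
  have k'0 : 0 <= j + e / 2 by rewrite addr_ge0 ?(ltW j0) ?(ltW e20).
  apply: le_trans (nu_le k'0 Hj) _.
  apply: le_trans (leeD2r _ (HN1 c d n n1 cdx wcd')).
  rewrite -ge0_muleDl// ?lee_fin// ?(ltW e0)//.
  apply: lee_wpmul2r; first exact: measure_ge0.
  rewrite -EFinD lee_fin -lerBlDr le_max; apply/orP; right; lra.
Qed.

Let le_of_scaled (x y : \bar R) :
  (forall e : R, 0 < e -> (x <= y + e%:E * mu (box a b))%E) -> (x <= y)%E.
Proof.
move=> H; apply/lee_addgt0Pr => e e0.
rewrite lebesgue3_box in H; last by move=> i; exact: ltW.
set p := \prod_i _ in H.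
have p0 : 0 < p by apply: prodr_gt0 => i _; rewrite subr_gt0.
have := H (e / p) (divr_gt0 e0 p0).
by rewrite -EFinM divfK// gt_eqF.
Qed.

Lemma measure_box_diffeo : im (box a b) = nu (box a b) /\ (im (box a b) < +oo)%E.
Proof.
split; last exact: im_box_lty.
apply/eqP; rewrite eq_le; apply/andP; split; apply: le_of_scaled => e e0.
- exact: im_le_nu.
- exact: nu_le_im.
Qed.

End on_box.

(** The volume of the image under F, as a function of the subset of A, has the
    absolute value of the Jacobian determinant as its density. It is enough to
    compare both measures on countably many boxes that cover A, and on the
    complement of A, which is null for both. *)
Lemma measure_image_diffeo (E : set V) : measurable E -> im E = nu E.
Proof.
move=> mE.
have [p [q [Apq pqA]]] := open_bigcup_box oA.
pose cover (n : nat) := if n is m.+1 then box (p m) (q m) else ~` A.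
have mcover n : measurable (cover n).
  by case: n => [|n] /=; [exact: measurableC|exact: measurable_box].
apply: (@g_sigma_algebra_measure_unique_cover _ _ _ measurable _ cover) => //.
- apply/seteqP; split => // x _; have [|xA] := pselect (A x).
    by rewrite [X in X _]Apq => -[n _ xn]; exists n.+1.
  by exists 0%N.
- move=> [|n] E' sE'.
    rewrite imE /nu/= /density; transitivity (0%E : \bar R).
      rewrite -[RHS](measure0 mu); congr (mu _); rewrite -subset0 => y.
      by move=> [/GB Ay [+ _]].
    apply/esym/integral0_eq => x [/= xA _].
    by rewrite /jac_density patchE memNset.
  have mQ := measurable_box (p n) (q n).
  have mE' : measurable E'.
    apply: smallest_sub sE' => //; exact: sigma_algebra_measurable.
  rewrite ![_ `&` E']setIC.
  apply: (@box_measure_unique R (mrestr im mQ) (mrestr nu mQ)) => //.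
    move=> a b; change (im (box a b `&` box (p n) (q n)) =
      nu (box a b `&` box (p n) (q n))); rewrite boxI.
    set a' := (X in box X _); set b' := (X in box _ X).
    have sub : cbox a' b' `<=` A.
      move=> x xab; apply: (pqA n) => i; have := xab i.
      by rewrite !mxE ge_max le_min => /andP[/andP[_ ->] /andP[_ ->]].
    have [ab|] := pselect (forall i, a' 0 i < b' 0 i).
      by have [] := measure_box_diffeo ab sub.
    move=> /existsNP[i /negP]; rewrite -leNgt => /box_eq0 ->.
    by rewrite !measure0.
  move=> k; change (im (centered_box k `&` box (p n) (q n)) < +oo)%E.
  have [ab|] := pselect (forall i, p n 0 i < q n 0 i).
    have [_ fin] := measure_box_diffeo ab (pqA n).
    apply: le_lt_trans fin; apply: le_measure; rewrite ?inE//.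
      by apply: measurableI => //; exact: measurable_box.
  move=> /existsNP[i /negP]; rewrite -leNgt => /box_eq0 ->.
  by rewrite setI0 measure0.
- exact: sub_sigma_algebra.
Qed.

Theorem ge0_change_of_variables (h : V -> R) :
  measurable_fun A (h \o F : V -> measurableTypeR R) ->
  (forall x, A x -> 0 <= h (F x)) ->
  (\int[mu]_(y in B) (h y)%:E =
   \int[mu]_(x in A) (h (F x) * `|\det ('J F x)|)%:E)%E.
Proof.
move=> mh h0; pose k : V -> R := (h \o F) \_ A.
have mk : measurable_fun setT (k : V -> measurableTypeR R).
  exact/(measurable_restrictT _ mA).
have k0 x : 0 <= k x.
  by rewrite /k patchE; case: ifPn => // /[1!inE]; exact: h0.
have mkE : measurable_fun setT (EFin \o k) by exact/measurable_EFinP.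
transitivity (\int[mu]_(y in B) (k (G' y))%:E)%E.
  apply: eq_integral => y /[1!inE] By; have Gy := GB By.
  by rewrite /k /G' [(G \_ B) y]patchE (mem_set By) patchE (mem_set Gy)/= FG.
transitivity (\int[mrestr mu mB]_y (k (G' y))%:E)%E.
  have kG0 y : (0 <= (k (G' y))%:E)%E by rewrite lee_fin.
  exact/esym/(integral_mrestr mu mB (measurableT_comp mkE mG') kG0).
transitivity (\int[im]_x (k x)%:E)%E.
  by rewrite (ge0_integral_pushforward mG')// => x _; rewrite lee_fin.
transitivity (\int[nu]_x (k x)%:E)%E.
  by apply: eq_measure_integral => E mE _; exact: measure_image_diffeo.
rewrite (ge0_integral_density mu measurable_jac_density jac_density_ge0 mk k0).
rewrite [RHS]integral_mkcond; apply: eq_integral => x _.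
by rewrite /k /jac_density !patchE; case: ifPn => _ //=; rewrite mul0r.
Qed.

(** The positive and negative parts of h transform separately. *)
Theorem change_of_variables (h : V -> R) :
  measurable_fun A (h \o F : V -> measurableTypeR R) ->
  (\int[mu]_(y in B) h y = \int[mu]_(x in A) (h (F x) * `|\det ('J F x)|))%R.
Proof.
move=> mh; rewrite /Rintegral; congr fine.
rewrite integralE [RHS]integralE; congr (_ - _)%E.
- rewrite (eq_integral (fun y => (Num.max (h y) 0)%:E)); last first.
    by move=> y _; rewrite funeposE -EFin_max.
  rewrite (ge0_change_of_variables (h := fun y => Num.max (h y) 0)).
  + by apply: eq_integral => x _; rewrite funeposE -EFin_max maxr_pMl// mul0r.
  + exact: measurable_maxr.
  + by move=> x _; rewrite le_max lexx orbT.
- rewrite (eq_integral (fun y => (Num.max (- h y) 0)%:E)); last first.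
    by move=> y _; rewrite funenegE -EFinN -EFin_max.
  rewrite (ge0_change_of_variables (h := fun y => Num.max (- h y) 0)).
  + apply: eq_integral => x _.
    by rewrite funenegE -EFinN -EFin_max maxr_pMl// mul0r mulNr.
  + by apply: measurable_maxr => //; exact: measurableT_comp.
  + by move=> x _; rewrite le_max lexx orbT.
Qed.

End change_of_variables.

(** The change of variables for a quantity transported like a density: the
    determinant in the formula cancels the one carried by h. *)
Lemma diffeomorphism_pullback (R : realType) (A B : set 'rV[R]_3)
    (F : 'rV[R]_3 -> 'rV[R]_3) (h k : 'rV[R]_3 -> R) :
  open A -> open B -> diffeomorphism A B F ->
  (forall x, A x -> 0 < \det ('J F x)) ->
  measurable_fun A (k : _ -> measurableTypeR R) ->
  (forall x, A x -> h (F x) = k x / \det ('J F x)) ->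
  \int[lebesgue3]_(y in B) h y = \int[lebesgue3]_(x in A) k x.
Proof.
move=> oA oB [[FA _ surj] [C1F [G [dG _] GF]]] J0 mk hk.
have GB y : B y -> A (G y) /\ F (G y) = y.
  by move=> /surj[x Ax <-]; rewrite GF.
rewrite (change_of_variables (G := G) oA oB C1F) //.
- apply: eq_Rintegral => x /[1!inE] Ax.
  by rewrite hk// gtr0_norm ?J0// divfK// gt_eqF// J0.
- by move=> y /GB[].
- by move=> y /GB[].
- apply: (@eq_measurable_fun _ _ _ _ A (fun x => k x * (\det ('J F x))^-1)).
    by move=> x /[1!inE] Ax /=; rewrite hk.
  apply: measurable_funM => //; apply: continuous_measurable_rV => //.
  rewrite continuous_open_subspace// => x /[1!inE] Ax.
  have [_] := C1F; rewrite continuous_open_subspace// => /(_ x).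
  rewrite inE => /(_ Ax) cJ.
  apply: (@continuous_comp _ _ _ (jacobian F) (fun M : 'M[R]_3 => (\det M)^-1) x) => //.
  apply: (@continuous_comp _ _ _ (fun M : 'M[R]_3 => \det M) (@GRing.inv R)).
    exact: continuous_det.
  by apply: inv_continuous; rewrite gt_eqF// J0.
Qed.

(** * Quadratic energies along differentiable curves *)

Section form.
Context {R : realType} {X : lmodType R}.
Variables (U : X -> Prop) (W : X -> X -> R).
Hypothesis U_lin : forall a u v, U u -> U v -> U (a *: u + v).
Hypothesis W_lin : forall a u v w, U u -> U v -> U w ->
  W (a *: u + v) w = a * W u w + W v w.
Hypothesis W_sym : forall u v, W u v = W v u.
Hypothesis W_ge0 : forall u, U u -> 0 <= W u u.

Let UD u v : U u -> U v -> U (u + v).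
Proof. by move=> Uu Uv; rewrite -[u]scale1r; exact: U_lin. Qed.

Let WDl u v w : U u -> U v -> U w -> W (u + v) w = W u w + W v w.
Proof. by move=> Uu Uv Uw; rewrite -[u in LHS]scale1r W_lin// mul1r. Qed.

Let WDr u v w : U u -> U v -> U w -> W w (u + v) = W w u + W w v.
Proof. by move=> *; rewrite W_sym WDl// !(W_sym w). Qed.

Let WLr a u v w : U u -> U v -> U w -> W w (a *: u + v) = a * W w u + W w v.
Proof. by move=> *; rewrite W_sym W_lin// !(W_sym w). Qed.

Lemma form_cauchy_schwarz u v : U u -> U v -> W u v ^+ 2 <= W u u * W v v.
Proof.
move=> Uu Uv.
have pos t : 0 <= W u u + 2 * t * W u v + t ^+ 2 * W v v.
  have := W_ge0 (U_lin t Uv Uu).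
  rewrite W_lin ?WLr//; last exact: U_lin.
  by rewrite (W_sym v u) => H; lra.
have := W_ge0 Uv; rewrite le_eqVlt => /predU1P[v0|v0].
  have [->|p0] := eqVneq (W u v) 0; first by rewrite expr0n/= -v0 mulr0.
  have := pos (- (W u u + 1) / (2 * W u v)).
  rewrite -v0 mulr0 addr0 (_ : 2 * _ * _ = - (W u u + 1)); last by field.
  by rewrite opprD addrA subrr add0r oppr_ge0 ler10.
have := pos (- W u v / W v v).
rewrite (_ : _ + _ = W u u - W u v ^+ 2 / W v v); last by field; rewrite gt_eqF.
by rewrite subr_ge0 ler_pdivrMr.
Qed.

(** By the Cauchy-Schwarz inequality, if a_s stays bounded and b_s tends to 0 in
    energy, then so does their product. *)
Lemma form_cvg0 (F : set_system R) {FF : Filter F} (a b : R -> X) (l : R) :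
  (\forall s \near F, U (a s)) -> (\forall s \near F, U (b s)) ->
  W (a s) (a s) @[s --> F] --> l -> W (b s) (b s) @[s --> F] --> (0 : R) ->
  W (a s) (b s) @[s --> F] --> (0 : R).
Proof.
move=> Ua Ub al b0.
have H : Num.sqrt (W (a s) (a s) * W (b s) (b s)) @[s --> F] --> (0 : R).
  rewrite -[0 in X in _ --> X]sqrtr0 -[X in Num.sqrt X](mulr0 l).
  apply: continuous_cvg; first exact: sqrt_continuous.
  exact: cvgM.
have HN : - Num.sqrt (W (a s) (a s) * W (b s) (b s)) @[s --> F] --> (0 : R).
  by rewrite -[0 in X in _ --> X]oppr0; exact: cvgN.
apply: (squeeze_cvgr _ HN H).
apply: filterS2 Ua Ub => s Ua Ub.
rewrite -ler_norml -sqrtr_sqr ler_sqrt; first exact: form_cauchy_schwarz.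
by rewrite mulr_ge0// W_ge0.
Qed.

Section curve.
Variables (F : set_system R) (t : R) (g dg : R -> X).
Context {FF : Filter F}.
Let err s := (s - t)^-1 *: (g s - g t) - dg t.
Let inc s := dg s - dg t.
Hypothesis Fid : s @[s --> F] --> t.
Hypothesis Fneq : \forall s \near F, s != t.
Hypothesis Ug : \forall s \near F, U (g s).
Hypothesis Udg : \forall s \near F, U (dg s).
Hypothesis Ugt : U (g t).
Hypothesis Udgt : U (dg t).
Hypothesis err0 : W (err s) (err s) @[s --> F] --> (0 : R).
Hypothesis inc0 : W (inc s) (inc s) @[s --> F] --> (0 : R).

Let UB u v : U u -> U v -> U (u - v).
Proof. by move=> Uu Uv; rewrite addrC -scaleN1r; exact: U_lin. Qed.

Let U0 : U 0. Proof. by rewrite -(subrr (g t)); exact: UB. Qed.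

Let Uerr : \forall s \near F, U (err s).
Proof.
apply: filterS Ug => s Us; rewrite /err.
by apply: UB => //; rewrite -[_ *: _]addr0; apply: U_lin => //; exact: UB.
Qed.

Let Uinc : \forall s \near F, U (inc s).
Proof. by apply: filterS Udg => s Us; exact: UB. Qed.

Let gE s : s != t -> g s = (s - t) *: (dg t + err s) + g t.
Proof.
move=> st; rewrite /err (addrC (dg t)) subrK scalerA mulfV ?subr_eq0// scale1r.
by rewrite subrK.
Qed.

Let Fsub0 : s - t @[s --> F] --> (0 : R).
Proof. by rewrite -[0 in X in _ --> X](subrr t); apply: cvgB => //; exact: cvg_cst. Qed.

Let near_cst (P : Prop) : P -> \forall s \near F, P.
Proof. by move=> p; exact: nearW. Qed.

Let cvg_W_err u : U u -> W u (err s) @[s --> F] --> (0 : R).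
Proof.
move=> Uu; apply: (form_cvg0 (a := fun=> u) (l := W u u)) => //.
- exact: near_cst.
- exact: cvg_cst.
Qed.

Let cvg_W_inc u : U u -> W u (inc s) @[s --> F] --> (0 : R).
Proof.
move=> Uu; apply: (form_cvg0 (a := fun=> u) (l := W u u)) => //.
- exact: near_cst.
- exact: cvg_cst.
Qed.

Let cvg_slope : W (dg t + err s) (dg t + err s) @[s --> F] --> W (dg t) (dg t).
Proof.
have : W (dg t) (dg t) + 2 * W (dg t) (err s) + W (err s) (err s) @[s --> F] -->
    W (dg t) (dg t) + 2 * 0 + 0.
  apply: cvgD => //; apply: cvgD; first exact: cvg_cst.
  by apply: cvgM; [exact: cvg_cst|exact: cvg_W_err].
rewrite mulr0 !addr0; apply: cvg_trans; apply: near_eq_cvg.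
apply: filterS Uerr => s Us.
rewrite (WDl Udgt Us (UD Udgt Us)) (WDr Udgt Us Udgt) (WDr Udgt Us Us).
by rewrite (W_sym (err s) (dg t)); ring.
Qed.

(** With g s = g t + (s - t) (dg t + err s), the difference quotient is equal to
    W (g t) (dg t) + W (g t) (err s) plus (s - t) / 2 times the bounded energy of
    dg t + err s. *)
Lemma form_energy_quotient :
  (s - t)^-1 * (2^-1 * W (g s) (g s) - 2^-1 * W (g t) (g t)) @[s --> F] -->
  W (g t) (dg t).
Proof.
have : W (g t) (dg t) + W (g t) (err s) +
    (s - t) * (2^-1 * W (dg t + err s) (dg t + err s)) @[s --> F] -->
    W (g t) (dg t) + 0 + 0 * (2^-1 * W (dg t) (dg t)).
  apply: cvgD; first by apply: cvgD; [exact: cvg_cst|exact: cvg_W_err].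
  by apply: cvgM => //; apply: cvgM; [exact: cvg_cst|exact: cvg_slope].
rewrite mul0r !addr0; apply: cvg_trans; apply: near_eq_cvg.
apply: filterS2 Uerr Fneq => s Us st.
have Ude : U (dg t + err s) by exact: UD.
have Usde : U ((s - t) *: (dg t + err s) + g t) by exact: U_lin.
rewrite (gE st); move: (err s) Us Ude Usde => e Ue Ude Usde.
rewrite (W_lin _ Ude Ugt Usde) (WLr _ Ude Ugt Ude) (WLr _ Ude Ugt Ugt).
rewrite (W_sym (dg t + e) (g t)) (WDr Udgt Ue Ugt).
by field; rewrite subr_eq0.
Qed.

Lemma form_power_cvg : W (g s) (dg s) @[s --> F] --> W (g t) (dg t).
Proof.
have c1 : W (dg t + err s) (inc s) @[s --> F] --> (0 : R).
  apply: (form_cvg0 (a := fun s => dg t + err s)) cvg_slope inc0 => //.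
  by apply: filterS Uerr => s Us; exact: UD.
have : W (g t) (dg t) + W (g t) (inc s) + (s - t) *
    (W (dg t) (dg t) + W (dg t) (err s) + W (dg t + err s) (inc s)) @[s --> F] -->
    W (g t) (dg t) + 0 + 0 * (W (dg t) (dg t) + 0 + 0).
  apply: cvgD; first by apply: cvgD; [exact: cvg_cst|exact: cvg_W_inc].
  apply: cvgM => //; apply: cvgD => //.
  by apply: cvgD; [exact: cvg_cst|exact: cvg_W_err].
rewrite mul0r !addr0; apply: cvg_trans; apply: near_eq_cvg.
apply: filterS3 Uerr Uinc Fneq => s Us Ui st.
have Ude : U (dg t + err s) by exact: UD.
have ds : dg s = dg t + inc s by rewrite /inc addrC subrK.
rewrite (gE st) ds; move: (err s) (inc s) Us Ui Ude => e i Ue Ui Ude.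
rewrite (W_lin _ Ude Ugt (UD Udgt Ui)) (WDr Udgt Ui Ude) (WDr Udgt Ui Ugt).
rewrite (WDl Udgt Ue Udgt) (W_sym e (dg t)).
by ring.
Qed.

End curve.
End form.

(** * The kinetic energy in Lagrangian coordinates *)

Section weighted_form.
Context {R : realType}.
Local Notation V := 'rV[R]_3.
Local Notation mu := (@lebesgue3 R).
Variables (A : set V) (r : V -> R).
Hypothesis mA : measurable A.
Hypothesis hr : material_datum A r.

(** With the initial density as weight, 1 / 2 wform g g is the kinetic energy of
    the velocity g in Lagrangian coordinates. *)
Definition wform (v w : V -> V) : R := \int[mu]_(x in A) (r x * dotv (v x) (w x)).

Lemma L2_lin (a : R) (f g : V -> R) : L2 A f -> L2 A g ->
  L2 A (fun x => a * f x + g x).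
Proof.
move=> Lf Lg; rewrite /L2.
have [_ lin] := @Lfun_submod_closed _ _ R mu 2%:E ltac:(by rewrite lee_fin ler1n).
suff -> : (fun x => a * f x + g x) \_ A = a *: (f \_ A) + (g \_ A).
  exact: lin.
apply/funext => x; rewrite [RHS]/= !fctE !patchE.
by case: ifPn => // _; rewrite scaler0 addr0.
Qed.

Lemma L2v_lin (a : R) (u v : V -> V) : L2v A u -> L2v A v -> L2v A (a *: u + v).
Proof.
move=> Lu Lv i.
rewrite (_ : coordf _ i = fun x => a * coordf u i x + coordf v i x).
  exact: L2_lin.
by apply/funext => x; rewrite /coordf !fctE !mxE.
Qed.

Lemma L2_mul_integrable (f g : V -> R) : L2 A f -> L2 A g ->
  mu.-integrable A (fun x => (f x * g x)%:E).
Proof.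
move=> Lf Lg; apply/integrable_mkcond => //.
have /Lfun1_integrable := Lfun2_mul_Lfun1 Lf Lg.
by apply: eq_integrable => // x _; rewrite /= !patchE; case: ifPn => //; rewrite mul0r.
Qed.

Lemma dotv_integrable (u v : V -> V) : L2v A u -> L2v A v ->
  mu.-integrable A (fun x => (dotv (u x) (v x))%:E).
Proof.
move=> Lu Lv.
have : mu.-integrable A (fun x => (\sum_i (u x 0 i * v x 0 i)%:E)%E).
  by apply: integrable_sum => // i _; exact: L2_mul_integrable (Lu i) (Lv i).
by apply: eq_integrable => // x _; rewrite sumEFin.
Qed.

Lemma wform_integrable (u v : V -> V) : L2v A u -> L2v A v ->
  mu.-integrable A (fun x => (r x * dotv (u x) (v x))%:E).
Proof.
move=> Lu Lv; have [mr [c [C [c0 rC]]]] := hr.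
have : mu.-integrable A ((EFin \o r) \* (fun x => (dotv (u x) (v x))%:E))%E.
  apply: integrableMr => //; last exact: dotv_integrable.
  exists C; split; first exact: num_real.
  move=> C' CC' x Ax; have /andP[cx xC] := rC x Ax.
  by rewrite /= ger0_norm ?(le_trans (ltW c0))// (le_trans xC)// ltW.
by apply: eq_integrable.
Qed.

Lemma wform_measurable (u v : V -> V) : L2v A u -> L2v A v ->
  measurable_fun A (fun x => r x * dotv (u x) (v x) : measurableTypeR R).
Proof.
by move=> Lu Lv; apply/measurable_EFinP; exact: measurable_int (wform_integrable Lu Lv).
Qed.

Lemma dotvC (a b : V) : dotv a b = dotv b a.
Proof. by rewrite /dotv; apply: eq_bigr => i _; rewrite mulrC. Qed.

Lemma dotv_ge0 (a : V) : 0 <= dotv a a.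
Proof. by rewrite /dotv sumr_ge0// => i _; rewrite -expr2 sqr_ge0. Qed.

Lemma dotv_lin (k : R) (a b c : V) : dotv (k *: a + b) c = k * dotv a c + dotv b c.
Proof.
rewrite /dotv mulr_sumr -big_split/=; apply: eq_bigr => i _.
by rewrite !mxE mulrDl mulrA.
Qed.

Lemma wformC v w : wform v w = wform w v.
Proof. by rewrite /wform; under eq_Rintegral do rewrite dotvC. Qed.

Lemma wform_ge0 v : 0 <= wform v v.
Proof.
have [_ [c [C [c0 rC]]]] := hr.
apply: Rintegral_ge0 => x Ax; rewrite mulr_ge0 ?dotv_ge0//.
by have /andP[+ _] := rC x Ax; apply: le_trans (ltW c0).
Qed.

Lemma wform_lin a u v w : L2v A u -> L2v A v -> L2v A w ->
  wform (a *: u + v) w = a * wform u w + wform v w.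
Proof.
move=> Lu Lv Lw; have iu := wform_integrable Lu Lw; have iv := wform_integrable Lv Lw.
rewrite /wform -RintegralZl// -RintegralD//; last first.
  have := integrableZl mA a iu; apply: eq_integrable => // x _.
by apply: eq_Rintegral => x _; rewrite !fctE dotv_lin mulrDr mulrCA.
Qed.

Lemma wform_le_inner : exists2 C : R, 0 <= C &
  forall v, L2v A v -> wform v v <= C * inner_v A v v.
Proof.
have [mr [c [C [c0 rC]]]] := hr.
exists (Num.max 0 C); first by rewrite le_max lexx.
move=> v Lv; rewrite /inner_v -RintegralZl//; last exact: dotv_integrable.
apply: le_Rintegral => //; first exact: wform_integrable.
  have := integrableZl mA (Num.max 0 C) (dotv_integrable Lv Lv).
  by apply: eq_integrable.
move=> x Ax; rewrite ler_wpM2r ?dotv_ge0//.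
by have /andP[_ xC] := rC x Ax; rewrite le_max xC orbT.
Qed.

End weighted_form.

Section lagrangian_energy.
Context {R : realType}.
Local Notation V := 'rV[R]_3.
Variables (T : R) (A : set V) (r : V -> R) (g dg : R -> V -> V).
Hypothesis mA : measurable A.
Hypothesis hr : material_datum A r.
Hypothesis hg : C1_L2 T A g dg.
Local Notation W := (wform A r).

Let Fl (t : R) : set_system R := within `[0, T] t^'.

Let Fl_sub (t : R) (S : set R) : (\forall s \near t, S s) -> \forall s \near Fl t, S s.
Proof.
move=> tS; rewrite /Fl near_withinE.
have : \forall s \near t, s != t -> `[0, T]%classic s -> S s.
  by apply: filterS tS.
by [].
Qed.

Let Fl_in (t : R) : \forall s \near Fl t, 0 <= s <= T.
Proof.
rewrite /Fl near_withinE; apply: (@nearW _ (t^')) => s.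
by rewrite /= in_itv.
Qed.

Let Fl_neq (t : R) : \forall s \near Fl t, s != t.
Proof.
rewrite /Fl near_withinE.
have : \forall s \near t, s != t -> `[0, T]%classic s -> s != t.
  exact: (@nearW _ (nbhs t)).
by [].
Qed.

Let W_cvg0 (F : set_system R) {FF : Filter F} (v : R -> V -> V) :
  (\forall s \near F, L2v A (v s)) ->
  inner_v A (v s) (v s) @[s --> F] --> (0 : R) -> W (v s) (v s) @[s --> F] --> (0 : R).
Proof.
move=> Lv v0; have [C C0 WC] := wform_le_inner mA hr.
have Cv : C * inner_v A (v s) (v s) @[s --> F] --> (0 : R).
  by rewrite -[0 in X in _ --> X](mulr0 C); apply: cvgM => //; exact: cvg_cst.
apply: (squeeze_cvgr _ (cvg_cst 0) Cv).
by apply: filterS Lv => s Ls; rewrite (wform_ge0 hr) WC.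
Qed.

Let L2vB (u v : V -> V) : L2v A u -> L2v A v -> L2v A (u - v).
Proof. by move=> Lu Lv; rewrite addrC -scaleN1r; exact: L2v_lin. Qed.

Let L2v0 (u : V -> V) : L2v A u -> L2v A 0.
Proof. by move=> Lu; rewrite -(subrr u); exact: L2vB. Qed.

Section at_time.
Variable t : R.
Hypothesis tT : 0 <= t <= T.

Let gt : L2v A (g t). Proof. by have [] := hg tT. Qed.
Let dgt : L2v A (dg t). Proof. by have [] := hg tT. Qed.
Let gF : \forall s \near Fl t, L2v A (g s).
Proof. by apply: filterS (Fl_in t) => s sT; have [] := hg sT. Qed.
Let dgF : \forall s \near Fl t, L2v A (dg s).
Proof. by apply: filterS (Fl_in t) => s sT; have [] := hg sT. Qed.

Let errF : W ((s - t)^-1 *: (g s - g t) - dg t) ((s - t)^-1 *: (g s - g t) - dg t)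
  @[s --> Fl t] --> (0 : R).
Proof.
apply: W_cvg0; last by have [] := hg tT.
apply: filterS gF => s Ls; apply: L2vB => //.
by rewrite -[_ *: _]addr0; apply: L2v_lin; [exact: L2vB|exact: L2v0 gt].
Qed.

Let incF : W (dg s - dg t) (dg s - dg t) @[s --> Fl t] --> (0 : R).
Proof.
apply: W_cvg0; first by apply: filterS dgF => s Ls; exact: L2vB.
have [_ _ _ H] := hg tT; apply: cvg_trans H.
apply: cvg_app; rewrite /Fl => S; rewrite /within /= => H.
exact: nbhs_dnbhs H.
Qed.

Let idF : s @[s --> Fl t] --> t.
Proof. by move=> S tS; exact: Fl_sub. Qed.

Lemma lagrangian_energy_quotient :
  (s - t)^-1 * (2^-1 * W (g s) (g s) - 2^-1 * W (g t) (g t)) @[s --> Fl t] -->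
  W (g t) (dg t).
Proof.
exact: (@form_energy_quotient R _ (L2v A) W (@L2v_lin R A)
  (@wform_lin R A r mA hr) (@wformC R A r) (fun v _ => wform_ge0 hr v)
  (Fl t) t g dg _ idF (Fl_neq t) gF gt dgt errF).
Qed.

Lemma lagrangian_power_cvg : W (g s) (dg s) @[s --> Fl t] --> W (g t) (dg t).
Proof.
exact: (@form_power_cvg R _ (L2v A) W (@L2v_lin R A)
  (@wform_lin R A r mA hr) (@wformC R A r) (fun v _ => wform_ge0 hr v)
  (Fl t) t g dg _ idF (Fl_neq t) gF dgF gt dgt errF incF).
Qed.

End at_time.
End lagrangian_energy.

(** * Differentiation and integration in time *)

Section one_sided.
Context {R : realType}.
Variables (T : R) (E P : R -> R).
Let Fl (t : R) : set_system R := within `[0, T] t^'.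
Hypothesis quot : forall t : R, 0 <= t <= T ->
  (s - t)^-1 * (E s - E t) @[s --> Fl t] --> P t.
Hypothesis Pcont : forall t : R, 0 <= t <= T -> P s @[s --> Fl t] --> P t.

(** Limits along the punctured interval determine continuity, the value at the
    point itself being trivially close. *)
Lemma punctured_continuous_within (f : R -> R) :
  (forall t : R, 0 <= t <= T -> f s @[s --> Fl t] --> f t) ->
  {within `[0, T], continuous f}.
Proof.
move=> fc; apply/subspace_continuousP => t; rewrite /= in_itv/= => tT.
apply/cvgrPdist_lt => e e0; have /cvgrPdist_lt/(_ e e0) := fc t tT.
rewrite /Fl !near_withinE => H.
have : \forall x \near t, x != t -> `[0, T]%classic x -> `|f t - f x| < e := H.
apply: filterS => x Hx; have [->|xt] := eqVneq x t; first by rewrite subrr normr0.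
exact: Hx.
Qed.

Lemma energy_continuous : {within `[0, T], continuous E}.
Proof.
apply: punctured_continuous_within => t tT.
have : E t + (s - t) * ((s - t)^-1 * (E s - E t)) @[s --> Fl t] --> E t + 0 * P t.
  apply: cvgD; first exact: cvg_cst.
  apply: cvgM; last exact: quot.
  rewrite -[0 in X in _ --> X](subrr t); apply: cvgB; last exact: cvg_cst.
  apply: (cvg_trans _ (@cvg_id _ (nbhs t))).
  by move=> S; rewrite /Fl /within => tS; apply: filterS tS.
rewrite mul0r addr0; apply: cvg_trans; apply: near_eq_cvg.
rewrite /Fl near_withinE.
have : \forall x \near t, x != t -> `[0, T]%classic x ->
    E t + (x - t) * ((x - t)^-1 * (E x - E t)) = E x.
  by apply: (@nearW _ (nbhs t)) => x xt _; rewrite mulVKf ?subr_eq0// addrC subrK.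
by [].
Qed.

Lemma energy_derivable (t : R) : 0 < t < T -> derivable E t 1 /\ derive1 E t = P t.
Proof.
move=> /andP[t0 tT].
suff H : h^-1 *: ((E \o shift t) (h *: 1) - E t) @[h --> 0^'] --> P t.
  split; first by apply/cvg_ex; exists (P t).
  by rewrite derive1E; exact: cvg_lim H.
have tT' : 0 <= t <= T by rewrite !ltW.
apply/cvgrPdist_lt => e e0; have /cvgrPdist_lt/(_ e e0) := quot tT'.
rewrite /Fl !near_withinE => H.
have {}H : \forall x \near t, x != t -> `[0, T]%classic x ->
   `|P t - (x - t)^-1 * (E x - E t)| < e := H.
have I : \forall x \near t, `[0, T]%classic x.
  have : \forall x \near t, x \in `]0, T[.
    by apply: near_in_itvoo; rewrite in_itv/= t0.
  by apply: filterS => x; rewrite /= !in_itv/= => /andP[/ltW -> /ltW ->].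
have [d /= d0 Hd] : nbhs_ball t (fun x => x != t ->
    `|P t - (x - t)^-1 * (E x - E t)| < e).
  by apply/nbhs_ballP; apply: filterS2 H I => x Hx Ix xt; exact: Hx.
apply/nbhs_ballP; exists d => //= x; rewrite /ball/= sub0r normrN => xd x0.
have := Hd (x + t); rewrite /ball/= opprD addrCA subrr addr0 normrN addrK.
rewrite /shift/= /GRing.scale/= mulr1; apply => //.
by rewrite -subr_eq0 addrK.
Qed.

(** E is continuous up to the endpoints and P is its continuous derivative in the
    interior, so the fundamental theorem of calculus applies. *)
Lemma energy_FTC (t : R) : 0 < t <= T ->
  lebesgue_measure.-integrable `[0, t] (EFin \o P) /\
  \int[lebesgue_measure]_(s in `[0, t]) P s = E t - E 0.
Proof.
move=> /andP[t0 tT].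
have sub : `[0, t]%classic `<=` `[0, T]%classic.
  by move=> x; rewrite /= !in_itv/= => /andP[-> /le_trans]; exact.
have cP : {within `[0, t], continuous P}.
  by apply: (continuous_subspaceW sub); exact: punctured_continuous_within.
have cE : {within `[0, t], continuous E}.
  by apply: (continuous_subspaceW sub); exact: energy_continuous.
split.
  by apply: continuous_compact_integrable => //; exact: segment_compact.
rewrite /Rintegral (@continuous_FTC2 _ P E)//.
  move/continuous_within_itvP : cE => /(_ t0)[_ ? ?].
  split => // x; rewrite in_itv/= => /andP[x0 xt].
  by have [] := @energy_derivable x _; rewrite // x0 (lt_le_trans xt).
move=> x; rewrite in_itv/= => /andP[x0 xt].
by have [] := @energy_derivable x _; rewrite // x0 (lt_le_trans xt).
Qed.

End one_sided.

(** A point is a null set, and a function that is measurable off a point is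
    measurable. *)
Lemma integrable_off_endpoint (R : realType) (f g : R -> R) (t : R) : 0 <= t ->
  (forall s, 0 < s <= t -> f s = g s) ->
  lebesgue_measure.-integrable `[0, t] (EFin \o g) ->
  lebesgue_measure.-integrable `[0, t] (EFin \o f) /\
  \int[lebesgue_measure]_(s in `[0, t]) f s =
  \int[lebesgue_measure]_(s in `[0, t]) g s.
Proof.
move=> t0 fg ig.
have sub : `]0, t]%classic `<=` `[0, t]%classic.
  by move=> s; rewrite /= !in_itv/= => /andP[/ltW -> ->].
have ig' : lebesgue_measure.-integrable `]0, t] (EFin \o g).
  by apply: integrableS ig.
have if' : lebesgue_measure.-integrable `]0, t] (EFin \o f).
  apply: eq_integrable ig' => //= s; rewrite inE/= in_itv/= => st.
  by rewrite fg.
have itvU : [set 0] `|` `]0, t]%classic = `[0, t]%classic.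
  apply/seteqP; split => [s [->|/sub//]|s] /=; rewrite !in_itv/= ?lexx//.
  move=> /andP[s0 st]; have [->|sn0] := eqVneq s 0; [by left|right].
  by rewrite lt_neqAle eq_sym sn0 s0.
have if0 : lebesgue_measure.-integrable `[0, t] (EFin \o f).
  have mf : measurable_fun `[0, t]%classic (EFin \o f).
    rewrite -itvU; apply/measurable_funU => //; split; first exact: measurable_fun_set1.
    exact: measurable_int if'.
  have null : lebesgue_measure [set 0 : R] = 0%E by exact: lebesgue_measure_set1.
  have [|||| _] := @negligible_integrable _ _ R lebesgue_measure
    `[0, t]%classic [set 0] (EFin \o f) => //.
  apply; apply: integrableS if' => //; first by apply: measurableD.
  by rewrite -itvU => s [[-> s0|//]]; case: s0.
split => //; rewrite -!Rintegral_itv_obnd_cbnd//.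
apply: eq_Rintegral => s; rewrite inE/= in_itv/= => st.
exact: fg.
Qed.

(** * The energy balance of the weak formulation *)

(** When the positive or the negative part of f has an infinite integral, both
    sides are 0 by convention. *)
Lemma RintegralN d (X : measurableType d) (R : realType)
    (m : {measure set X -> \bar R}) (D : set X) (f : X -> R) :
  \int[m]_(x in D) (- f x) = - \int[m]_(x in D) f x.
Proof.
rewrite /Rintegral integralE [in RHS]integralE.
have -> : (fun x => (- f x)%:E) = (\- (fun x => (f x)%:E))%E by [].
rewrite funeposN funenegN.
by case: (\int[m]_(x in D) _)%E => [a| |]; case: (\int[m]_(x in D) _)%E => [b| |];
  rewrite /= ?oppr0 ?opprB.
Qed.

(** Both sides are determinants with rows a, b, c up to the order of the rows. *)
Lemma dotv_crossv (R : realType) (a b c : 'rV[R]_3) :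
  dotv (crossv a b) c = - dotv (crossv c b) a.
Proof.
rewrite /dotv !sum_ord3 !mxE.
have -> : o0 + 1 = o1 by exact: val_inj.
have -> : o1 + 1 = o2 by exact: val_inj.
have -> : o2 + 1 = o0 by exact: val_inj.
have -> : o0 - 1 = o2 by exact: val_inj.
have -> : o1 - 1 = o0 by exact: val_inj.
have -> : o2 - 1 = o1 by exact: val_inj.
ring.
Qed.

Section weak_form.
Context {R : realType}.
Local Notation V := 'rV[R]_3.

(** The momentum equation is tested with u and Ohm's law with J. The pressure and
    the potential disappear because p and phi are themselves admissible in the
    two constraints, and the work of the Lorentz force is minus the electromotive
    term of Ohm's law, which thereby becomes the Joule dissipation. *)
Lemma weak_MHD_energy (Omega : set V) (Re alpha : R) (B : V -> V)
    (rho sigma nu : V -> R) (f J u du : V -> V) (phi p : V -> R) :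
  weak_MHD Omega Re alpha B rho sigma nu f J u du phi p ->
  inner_v Omega (fun x => rho x *: du x) u +
    dissipation Omega Re alpha sigma nu J u =
  inner_v Omega (fun x => rho x *: f x) u.
Proof.
move=> [[HJ Hu Hphi Hp] [ohm mom charge mass]].
have phiJ : inner_s Omega phi (wdiv Omega J) = 0.
  have := charge _ Hphi => /eqP; rewrite oppr_eq0 => /eqP <-.
  by apply: eq_Rintegral => x _; rewrite mulrC.
have pu : inner_s Omega p (wdiv Omega u) = 0.
  have := mass _ Hp => /eqP; rewrite oppr_eq0 => /eqP <-.
  by apply: eq_Rintegral => x _; rewrite mulrC.
have lorentz : inner_v Omega (fun x => crossv (J x) (B x)) u =
    - inner_v Omega (fun x => crossv (u x) (B x)) J.
  rewrite /inner_v -RintegralN; apply: eq_Rintegral => x _.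
  exact: dotv_crossv.
have := ohm _ HJ; rewrite phiJ subr0 => /eqP; rewrite subr_eq0 => /eqP ohmJ.
have := mom _ Hu; rewrite pu subr0 lorentz -ohmJ mulrN opprK => <-.
by rewrite /dissipation addrA.
Qed.

Lemma dissipation_ge0 (Omega : set V) (Re alpha : R) (sigma nu : V -> R)
    (J u : V -> V) : 0 < Re -> 0 <= alpha ->
  (forall x, Omega x -> 0 <= sigma x) -> (forall x, Omega x -> 0 <= nu x) ->
  0 <= dissipation Omega Re alpha sigma nu J u.
Proof.
move=> Re0 alpha0 sigma0 nu0; rewrite /dissipation addr_ge0//.
  rewrite mulr_ge0 ?invr_ge0 ?(ltW Re0)//; apply: Rintegral_ge0 => x Ox.
  rewrite /ddotm sumr_ge0// => i _; rewrite sumr_ge0// => j _.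
  rewrite mxE -mulrA -expr2 mulr_ge0 ?sqr_ge0// mulr_ge0//.
  exact: nu0.
rewrite mulr_ge0//; apply: Rintegral_ge0 => x Ox.
rewrite -[_ *: _]addr0 dotv_lin addr_ge0//.
  by rewrite mulr_ge0 ?dotv_ge0// invr_ge0 sigma0.
by rewrite /dotv sumr_ge0// => i _; rewrite mxE mul0r.
Qed.

End weak_form.

(** * The energy law *)

Unset Implicit Arguments.
Set Strict Implicit.
Set Printing Implicit Defensive.

Theorem theorem2p2 (R : realType) (T : R) (Omega : R -> set 'rV[R]_3)
  (M : R -> 'rV[R]_3 -> 'rV[R]_3)
  (rho0 sigma0 nu0 : 'rV[R]_3 -> R) (rho sigma nu : R -> 'rV[R]_3 -> R)
  (B : 'rV[R]_3 -> 'rV[R]_3) (f : R -> 'rV[R]_3 -> 'rV[R]_3)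
  (Re alpha : R)
  (J u dudt : R -> 'rV[R]_3 -> 'rV[R]_3) (phi p : R -> 'rV[R]_3 -> R)
  (hT : 0 < T) (hRe : 0 < Re) (halpha : 0 <= alpha)
  (hOmega : forall t : R, 0 <= t <= T -> bounded_lipschitz_domain (Omega t))
  (hM : flow_map T Omega u M)
  (hrho0 : material_datum (Omega 0) rho0)
  (hsigma0 : material_datum (Omega 0) sigma0)
  (hnu0 : material_datum (Omega 0) nu0)
  (hsigma : transported T (Omega 0) M sigma0 sigma)
  (hnu : transported T (Omega 0) M nu0 nu)
  (hrho : density_transported T (Omega 0) M rho0 rho)
  (hB_meas : forall (t : R) i, 0 <= t <= T -> measurable_fun (Omega t) (coordf B i))
  (hB_bnd : exists C : R, forall (t : R) x, 0 <= t <= T -> Omega t x -> `|B x| <= C)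
  (hdudt : material_derivative T (Omega 0) M u dudt)
  (hint : forall t : R, 0 < t <= T ->
     inertia_and_force_integrable (Omega t) (rho t) (f t) (dudt t))
  (hweak : forall t : R, 0 < t <= T ->
     weak_MHD (Omega t) Re alpha B (rho t) (sigma t) (nu t) (f t)
              (J t) (u t) (dudt t) (phi t) (p t)) :
  let E := fun t : R => energy (Omega t) (rho t) (u t) in
  let D := fun t : R =>
    dissipation (Omega t) Re alpha (sigma t) (nu t) (J t) (u t) in
  (forall t : R, 0 < t < T ->
     derivable E t 1 /\
     derive1 E t + D t = inner_v (Omega t) (fun x => rho t x *: f t x) (u t))
  /\
  ((forall (t : R) x, 0 <= t <= T -> Omega t x -> f t x = 0) ->
   forall t : R, 0 <= t <= T ->
     [/\ lebesgue_measure.-integrable `[0, t] (EFin \o D),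
         E t + \int[lebesgue_measure]_(s in `[0, t]) D s = E 0 &
         E t <= E 0]).
Proof.
move=> E D.
pose A := Omega 0.
have TT0 : 0 <= (0 : R) <= T by rewrite lexx ltW.
have oO (t : R) : 0 <= t <= T -> open (Omega t) by move=> /hOmega[].
have oA : open A by exact: oO.
have mA : measurable A by exact: open_measurable_rV.
pose g t x := u t (M t x); pose dg t x := dudt t (M t x).
have hg : C1_L2 T A g dg by exact: hdudt.
have Lg (t : R) : 0 <= t <= T -> L2v A (g t) by move=> /hg[].
have Ldg (t : R) : 0 <= t <= T -> L2v A (dg t) by move=> /hg[].
pose P t := wform A rho0 (g t) (dg t).
have pull (t : R) h k : 0 <= t <= T -> measurable_fun A (k : _ -> measurableTypeR R) ->
    (forall x, A x -> h (M t x) = k x / \det ('J (M t) x)) ->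
    \int[lebesgue3]_(y in Omega t) h y = \int[lebesgue3]_(x in A) k x.
  move=> tT mk hk; apply: (diffeomorphism_pullback oA (oO t tT)) mk hk.
    exact: (flow_diffeo hM tT).
  by move=> x Ax; exact: (flow_orientation hM tT Ax).
(* The density is the initial one divided by the Jacobian determinant, hence
   integrals over Omega t become integrals over A with a fixed weight. *)
have EE (t : R) : 0 <= t <= T -> E t = 2^-1 * wform A rho0 (g t) (g t).
  move=> tT; congr (_ * _); apply: pull => //.
    by apply: wform_measurable => //; exact: Lg.
  by move=> x Ax; rewrite hrho// mulrAC.
have PE (t : R) : 0 <= t <= T ->
    inner_v (Omega t) (fun x => rho t x *: dudt t x) (u t) = P t.
  move=> tT; apply: pull => //.
    by apply: wform_measurable => //; [exact: Lg|exact: Ldg].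
  move=> x Ax; rewrite hrho// -[_ *: _]addr0 dotv_lin.
  rewrite (_ : dotv 0 _ = 0); last by rewrite /dotv big1// => i _; rewrite mxE mul0r.
  by rewrite addr0 mulrAC dotvC.
have balance (t : R) : 0 < t <= T -> P t + D t =
    inner_v (Omega t) (fun x => rho t x *: f t x) (u t).
  move=> /[dup] /andP[/ltW t0 tT] tT'.
  by rewrite -(weak_MHD_energy (hweak t tT')) PE// t0.
have quot (t : R) : 0 <= t <= T ->
    (s - t)^-1 * (E s - E t) @[s --> within `[0, T] t^'] --> P t.
  move=> tT; have := lagrangian_energy_quotient mA hrho0 hg tT.
  apply: cvg_trans; apply: near_eq_cvg; rewrite near_withinE.
  apply: (@nearW _ (t^')) => s; rewrite /= in_itv/= => sT.
  by rewrite EE// EE.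
have Pcont (t : R) : 0 <= t <= T -> P s @[s --> within `[0, T] t^'] --> P t.
  by move=> tT; exact: (lagrangian_power_cvg mA hrho0 hg tT).
split.
  move=> t tT; have [dE E'] := energy_derivable quot tT.
  split => //; rewrite E' balance//.
  by case/andP: tT => -> /ltW ->.
move=> f0.
have DP (t : R) : 0 < t <= T -> D t = - P t.
  move=> tT; apply/eqP; rewrite -addr_eq0 addrC balance//.
  have tT' : 0 <= t <= T by case/andP: tT => /ltW -> ->.
  rewrite /inner_v /Rintegral integral0_eq//= => x Ox; congr EFin.
  rewrite f0// scaler0 /dotv big1// => i _.
  by rewrite mxE mul0r.
have D0 (t : R) : 0 <= t <= T -> 0 <= D t.
  move=> tT; have [[_ _ surj] _] := flow_diffeo hM tT.
  have tr (a0 : 'rV[R]_3 -> R) (a : R -> 'rV[R]_3 -> R) :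
      material_datum A a0 -> transported T A M a0 a ->
      forall y, Omega t y -> 0 <= a t y.
    move=> [_ [c [C [c0 aC]]]] tra y /surj[x Ax <-]; rewrite tra//.
    by have /andP[+ _] := aC x Ax; apply: le_trans (ltW c0).
  by apply: dissipation_ge0 => //; [exact: tr hsigma|exact: tr hnu].
move=> t /andP[]; rewrite le_eqVlt => /predU1P[<- _|t0 tT].
  rewrite set_itv1 Rintegral_set1 addr0; split => //.
  apply: null_set_integrable => //; first exact: measurable_fun_set1.
  exact: lebesgue_measure_set1.
have ttT : 0 < t <= T by rewrite t0.
have [iP intP] := energy_FTC quot Pcont ttT.
have iNP : lebesgue_measure.-integrable `[0, t] (EFin \o (fun s => - P s)).
  have := integrableN iP.
  by apply: eq_integrable.
(* The weak formulation says nothing about D 0, so the integrals of D and - P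
   are compared away from 0. *)
have DPt (s : R) : 0 < s <= t -> D s = - P s.
  by move=> /andP[s0 st]; rewrite DP// s0 (le_trans st).
have [iD intD] := integrable_off_endpoint (ltW t0) DPt iNP.
have balance_t : E t + \int[lebesgue_measure]_(s in `[0, t]) D s = E 0.
  by rewrite intD RintegralN intP opprB addrC subrK.
split => //; rewrite -balance_t lerDl; apply: Rintegral_ge0 => s.
rewrite /= in_itv/= => /andP[s0 st].
by apply: D0; rewrite s0 (le_trans st).
Qed.
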